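(* For every continuous even real-valued function $B$ on $[-1,1]$ and every integer $n\ge1$, $$\mathscr R_n[B]=\frac1{2(2n+1)}\int_{-1}^1B(x)\,\mathcal L\bigl(\mathsf P_n^2\bigr)(x)\,\mathrm dx.$$ If, in addition, $B\in C^2((-1,1))$, $\mathcal LB\in L^1(-1,1)$, and $(1-x^2)B'(x)\to0$ at both endpoints $x\to\pm1$, then $$\mathscr R_n[B]=\frac1{2(2n+1)}\int_{-1}^1\mathsf P_n(x)^2\,\mathcal LB(x)\,\mathrm dx.$$
   Context: $\mathsf P_n$ denotes the Legendre polynomial of degree $n$ with $\mathsf P_n(1)=1$, and $\mathcal L$ is the Legendre operator $\mathcal Lq=-\frac{\mathrm d}{\mathrm dx}\bigl((1-x^2)q'(x)\bigr)$. For a continuous even real-valued $B$ on $[-1,1]$ and $t\in\mathbb R$, let $\eta_t^B$ be the even probability measure on $[-1,1]$ $$\mathrm d\eta_t^B(x)=\frac{e^{tB(x)}}{\int_{-1}^1e^{tB(u)}\,\mathrm du}\,\mathrm dx.$$ The circle lift of an even probability measure $\eta$ on $[-1,1]$ is the distribution on the unit circle $\mathbb T$ of $e^{2i\arccos X}$, where $X$ has distribution $\eta$. For a conjugation-symmetric probability measure on $\mathbb T$ of infinite support, with monic orthogonal polynomials $\Phi_j$ and $\Phi_j^*(z)=z^j\overline{\Phi_j(1/\bar z)}$, the Verblunsky coefficients $\alpha_j\in(-1,1)$ are the real numbers given by $\Phi_{j+1}(z)=z\Phi_j(z)-\alpha_j\Phi_j^*(z)$, $\Phi_0=1$. Let $\alpha_j^B(t)$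 be the Verblunsky coefficients of the circle lift of $\eta_t^B$, and set $$\mathscr R_n[B]=\left.\frac{\mathrm d}{\mathrm dt}\alpha_{n-1}^B(t)\right|_{t=0}\qquad(n\ge1).$$ *)

(* Defs.v *)
From mathcomp Require Import all_boot all_order all_algebra.
From mathcomp Require Import complex.
From mathcomp Require Import all_classical all_reals all_analysis.

Set Implicit Arguments.
Unset Strict Implicit.
Unset Printing Implicit Defensive.

Import Order.TTheory GRing.Theory Num.Theory.
Import numFieldNormedType.Exports.

Local Open Scope classical_set_scope.
Local Open Scope complex_scope.
Local Open Scope ring_scope.

(* Rodrigues' formula; this is the normalization with value 1 at 1. *)
Definition legendre (R : realType) (n : nat) : {poly R} :=
  (2 ^+ n * n`!%:R)^-1 *: (('X ^+ 2 - 1) ^+ n)^`(n).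

Definition legendre_op (R : realType) (q : R -> R) : R -> R :=
  fun x => - derive1 (fun y => (1 - y ^+ 2) * derive1 q y) x.

Definition eta_density (R : realType) (B : R -> R) (t x : R) : R :=
  expR (t * B x) / \int[lebesgue_measure]_(u in `[-1, 1]) expR (t * B u).

Definition eta (R : realType) (B : R -> R) (t : R) :
    set (measurableTypeR R) -> \bar R :=
  fun A => (\int[lebesgue_measure]_(x in (A `&` `[(-1)%R, 1%R])%classic)
              (eta_density B t x)%:E)%E.

(* Measures on the unit circle are represented as Borel measures on the plane
   R * R that are carried by the circle; the plane is identified with R[i]
   through to_complex. *)
Definition to_complex (R : realType) (p : R * R) : R[i] := p.1 +i* p.2.

(* The point e^(2 i arccos x). *)
Definition circle_point (R : realType)
    (x : measurableTypeR R) : measurableTypeR R * measurableTypeR R :=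
  (cos (2 * acos x), sin (2 * acos x)).

Definition circle_lift (R : realType)
    (m : set (measurableTypeR R) -> \bar R) :
    set (measurableTypeR R * measurableTypeR R) -> \bar R :=
  pushforward m (@circle_point R).

Definition complex_integral (R : realType)
    (mu : set (measurableTypeR R * measurableTypeR R) -> \bar R)
    (f : R[i] -> R[i]) : R[i] :=
  fine (\int[mu]_p (complex.Re (f (to_complex p)))%:E)
    +i* fine (\int[mu]_p (complex.Im (f (to_complex p)))%:E).

Definition is_monic_orthogonal (R : realType)
    (mu : set (measurableTypeR R * measurableTypeR R) -> \bar R)
    (j : nat) (P : {poly R[i]}) : Prop :=
  [/\ P \is monic, size P = j.+1 &
      forall k : nat, (k < j)%N ->
        complex_integral mu (fun z => P.[z] * (z ^+ k)^*) = 0].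

(* In the next definition and in verblunsky, the value 0 is junk, returned when
   no object satisfies the condition; when mu is a conjugation-symmetric
   probability measure on the circle with infinite support, exactly one does. *)
Definition monic_orthogonal (R : realType)
    (mu : set (measurableTypeR R * measurableTypeR R) -> \bar R)
    (j : nat) : {poly R[i]} :=
  xget 0 [set P | is_monic_orthogonal mu j P].

(* Meaningful for z != 0 only, since 0^-1 = 0. *)
Definition reversed (R : realType) (j : nat) (P : {poly R[i]}) (z : R[i]) :
    R[i] :=
  z ^+ j * (P.[(z^*)^-1])^*.

(* The recurrence is a polynomial identity, hence it is enough to
   require it for z != 0. *)
Definition verblunsky (R : realType)
    (mu : set (measurableTypeR R * measurableTypeR R) -> \bar R)
    (j : nat) : R :=
  xget 0 [set a : R | forall z : R[i], z != 0 ->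
    (monic_orthogonal mu j.+1).[z] =
      z * (monic_orthogonal mu j).[z]
      - a%:C * reversed j (monic_orthogonal mu j) z].

Definition verblunsky_path (R : realType) (B : R -> R) (j : nat) (t : R) : R :=
  verblunsky (circle_lift (eta B t)) j.

Definition response (R : realType) (n : nat) (B : R -> R) : R :=
  derive1 (verblunsky_path B n.-1) 0.

Definition C2_on_interior (R : realType) (B : R -> R) : Prop :=
  forall x : R, x \in `]-1, 1[ ->
    [/\ derivable B x 1, derivable (derive1 B) x 1 &
        {for x, continuous (derive1 (derive1 B))}].

(* Main.v *)
(** Write [z = u^2] with [u = x + i sqrt (1 - x^2)], so that the circle lift of an
    even weight [w] on [[-1, 1]] has inner product
    [form w p q = int Re (p(z) conj (q(z))) w] on real polynomials.  The monic
    orthogonal polynomials are produced by the Szego recursion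
    [p_(j+1) = z p_j - a_j p_j^*]; since they are unique, the [a_j] are the
    Verblunsky coefficients, and rescaling [w] does not change them.

    Pairing the [(n+1)]-st polynomial of the weight [e^(tB)] with the reversed
    [n]-th polynomial of the weight [1] isolates the constant term
    [- a_n(t)], whence the derivative of [a_n] at [0] is
    [form B p_(n+1) p_n^* / form 1 p_n p_n].

    For the weight [1] the Legendre recurrences give, by induction on [n],
    [p_n(u^2) = c_n u^n ((n+1) P_n(x) + i sqrt (1 - x^2) P_n'(x))] with
    [c_(n+1) = c_n (2n+2)/(2n+3)] and [a_n = -1/(2n+3)].  The integrand of
    [form B p_(n+1) p_n^*] is then
    [c_n c_(n+1) ((n+1)(n+2) P_(n+1)^2 - (1 - x^2) P_(n+1)'^2) B], and the
    bracket is half of the Legendre operator applied to [P_(n+1)^2].  The second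
    formula follows from Green's identity on compact subintervals. *)
From HB Require Import structures.
Require Import Defs.
From mathcomp Require Import all_boot all_order all_algebra.
From mathcomp Require Import complex ring lra zify.
From mathcomp Require Import all_classical all_reals all_analysis.
From mathcomp Require Import measurable_realfun.
Import Order.TTheory GRing.Theory Num.Theory.
Import numFieldNormedType.Exports.
Local Open Scope classical_set_scope.
Local Open Scope ring_scope.

Set Implicit Arguments.
Unset Strict Implicit.
Unset Printing Implicit Defensive.

(** * Legendre polynomials *)

(** Leibniz rule, which stops after the first derivative of ['X]. For [m = 0] the truncated index
    [m.-1] is harmless, because its term has multiplicity 0; the same holds for the truncated
    indices in the next lemma. *)
Lemma derivn_mulX (R : nzRingType) (p : {poly R}) (m : nat) :
  ('X * p)^`(m) = 'X * p^`(m) + p^`(m.-1) *+ m.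
Proof.
case: m => [|m]; first by rewrite !derivn0 mulr0n addr0.
have := derivnMXaddC m p 0.
by rewrite polyC0 addr0 -!commr_polyX => ->; rewrite addrC.
Qed.

Lemma derivn_mulX2_subr1 (R : comNzRingType) (p : {poly R}) (m : nat) :
  (('X^2 - 1) * p)^`(m) =
    ('X^2 - 1) * p^`(m) + 'X * p^`(m.-1) *+ m.*2 + p^`(m.-2) *+ (m * m.-1).
Proof.
rewrite mulrBl mul1r derivnB expr2 -mulrA !derivn_mulX.
rewrite -mul2n mulrnDl -!mulrnA.
by ring.
Qed.

Lemma deriv_natl (R : nzRingType) (k : nat) (p : {poly R}) :
  (k%:R * p)^`() = k%:R * p^`().
Proof. by rewrite !mulr_natl derivMn. Qed.

Lemma derivn_natl (R : nzRingType) (k m : nat) (p : {poly R}) :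
  (k%:R * p)^`(m) = k%:R * p^`(m).
Proof. by rewrite !mulr_natl derivnMn. Qed.

Section Legendre.
Variable R : realType.
Implicit Type n : nat.
Local Notation P := (legendre R).

Let W : {poly R} := 'X^2 - 1.

Lemma legendre0 : P 0 = 1.
Proof. by rewrite /legendre expr0 mul1r fact0 invr1 scale1r expr0. Qed.

Let legendreE n : (W ^+ n)^`(n) = (2 ^ n * n`!)%:R * P n.
Proof.
rewrite /legendre -polyC_natr mul_polyC scalerA natrM natrX.
rewrite mulfV ?scale1r // mulf_neq0 ?expf_neq0 ?pnatr_eq0 // -lt0n fact_gt0.
Qed.

Let deriv_W n : (W ^+ n.+1)^`() = (2 * n.+1)%:R * ('X * W ^+ n).
Proof.
rewrite deriv_exp /W derivB derivXn -polyC1 derivC subr0 /= expr1.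
by rewrite -mulr_natl natrM; ring.
Qed.

Let fact_neq0 n : (2 ^ n * n`!)%:R != 0 :> {poly R}.
Proof.
rewrite -polyC_natr polyC_eq0 pnatr_eq0 muln_eq0 negb_or.
by rewrite -!lt0n fact_gt0 expn_gt0.
Qed.

(** Differentiate [W ^+ n.+1] once, which gives [2 (n+1) X W^n], and then [n+1] more times by the
    Leibniz rule. *)
Lemma deriv_legendreS n : (P n.+1)^`() = 'X * (P n)^`() + n.+1%:R * P n.
Proof.
apply: (mulfI (fact_neq0 n.+1)).
have -> : (2 ^ n.+1 * n.+1`!)%:R * (P n.+1)^`() = (W ^+ n.+1)^`(n.+2).
  by rewrite derivnS legendreE deriv_natl.
rewrite derivSn deriv_W derivn_natl derivn_mulX.
rewrite -[n.+1.-1]/n derivnS legendreE deriv_natl expnS factS !natrM.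
by ring.
Qed.

(* Both expansions of the (n+1)-st derivative of W * W^n = W^(n+1), the second
   one starting from its first derivative, involve the (n-1)-st derivative of
   W^n; eliminating it leaves the recurrence. *)
Lemma legendreS n :
  n.+1%:R * P n.+1 = n.+1%:R * ('X * P n) + ('X^2 - 1) * (P n)^`().
Proof.
pose Y := (W ^+ n)^`(n.-1) *+ (n.+1 * n).
have E1 : (W ^+ n.+1)^`(n.+1) =
    (2 ^ n * n`!)%:R * (W * (P n)^`() + (2 * n.+1)%:R * ('X * P n)) + Y.
  rewrite exprS derivn_mulX2_subr1 derivnS legendreE.
  rewrite deriv_natl /Y /W -[n.+1.-1]/n -[n.+1.-2]/n.-1 -mul2n.
  by rewrite natrM; ring.
have E2 : (W ^+ n.+1)^`(n.+1) =
    (2 ^ n * n`!)%:R * ((2 * n.+1)%:R * ('X * P n)) + Y *+ 2.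
  rewrite derivSn deriv_W derivn_natl derivn_mulX legendreE /Y !natrM.
  by ring.
apply: (mulfI (fact_neq0 n)).
have two0 : 2 != 0 :> {poly R} by rewrite -polyC_natr polyC_eq0 pnatr_eq0.
apply: (mulfI two0).
have -> : 2 * ((2 ^ n * n`!)%:R * (n.+1%:R * P n.+1)) = (W ^+ n.+1)^`(n.+1).
  by rewrite legendreE expnS factS !natrM; ring.
have -> : (W ^+ n.+1)^`(n.+1) =
    2 * (W ^+ n.+1)^`(n.+1) - (W ^+ n.+1)^`(n.+1) by ring.
by rewrite {1}E1 E2 /W natrM; ring.
Qed.

(** By [legendreS] the expression under the outer derivative is [(n+1) (P_(n+1) - X P_n)], whose
    derivative [deriv_legendreS] evaluates. *)
Lemma legendre_ode n :
  (('X^2 - 1) * (P n)^`())^`() = (n * n.+1)%:R * P n.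
Proof.
have -> : ('X^2 - 1) * (P n)^`() =
    n.+1%:R * P n.+1 - n.+1%:R * ('X * P n) by rewrite legendreS; ring.
rewrite derivB !deriv_natl derivM derivX.
by rewrite deriv_legendreS natrM -[n.+1]addn1 natrD; ring.
Qed.

End Legendre.

(** * Polynomials on the circle *)

(** The polynomial [z^j p(1/z)] for [p] of degree at most [j]. For real coefficients and [z != 0] it
    takes the values of [reversed]. *)
Definition rev_poly (R : nzRingType) (j : nat) (p : {poly R}) : {poly R} :=
  \poly_(i < j.+1) p`_(j - i).

Lemma coef_rev_poly (R : nzRingType) (j : nat) (p : {poly R}) (i : nat) :
  (rev_poly j p)`_i = if (i < j.+1)%N then p`_(j - i) else 0.
Proof. exact: coef_poly. Qed.

Lemma horner_rev_poly (F : fieldType) (j : nat) (p : {poly F}) (z : F) :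
  z != 0 -> (size p <= j.+1)%N -> (rev_poly j p).[z] = z ^+ j * p.[z^-1].
Proof.
move=> z0 sp; rewrite horner_poly (horner_coef_wide _ sp) mulr_sumr.
rewrite [RHS](reindex_inj rev_ord_inj) /=.
apply: eq_bigr => i _; rewrite subSS mulrCA; congr (_ * _).
have ij : (i <= j)%N by rewrite -ltnS.
by rewrite exprVn -{2}(subnK ij) exprD mulrAC mulfV ?mul1r // expf_neq0.
Qed.

Lemma map_rev_poly (R S : nzRingType) (f : {rmorphism R -> S}) (j : nat)
    (p : {poly R}) : map_poly f (rev_poly j p) = rev_poly j (map_poly f p).
Proof.
apply/polyP => i; rewrite coef_map !coef_rev_poly coef_map.
by case: ifP => // _; exact: rmorph0.
Qed.

Lemma size_rev_poly (R : nzRingType) (j : nat) (p : {poly R}) :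
  (size (rev_poly j p) <= j.+1)%N.
Proof. exact: size_poly. Qed.

Lemma rev_poly_Xn (R : nzRingType) (j i : nat) : (i <= j)%N ->
  rev_poly j ('X^i : {poly R}) = 'X^(j - i).
Proof.
move=> ij; apply/polyP => k; rewrite coef_rev_poly !coefXn ltnS.
have [kj|jk] := leqP k j.
  by congr ((nat_of_bool _)%:R); apply/eqP/eqP; lia.
by case: eqP => // kE; move: jk; rewrite kE ltnNge leq_subr.
Qed.

(** The two reversals are taken in degrees [j] and [j+1]; the mismatch leaves a factor ['X]. *)
Lemma rev_polyK (R : nzRingType) (j : nat) (p : {poly R}) :
  (size p <= j.+1)%N -> rev_poly j.+1 (rev_poly j p) = 'X * p.
Proof.
move=> sp; apply/polyP => k; rewrite coefXM !coef_rev_poly.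
case: k => [|k] /=; first by rewrite subn0 ltnn.
rewrite subSS !ltnS leq_subr; have [kj|jk] := leqP k j; first by rewrite subKn.
by rewrite nth_default // (leq_trans sp).
Qed.

(** * Half-angle parametrization and the pointwise Hermitian product *)

Section Circle.
Variable R : realType.
Local Open Scope complex_scope.
Implicit Types (p q : {poly R}) (x : R).

(* Clamping x to [-1, 1] makes the half-angle lift_point x + i sqrt (1 - x^2) a
   continuous function from the whole line to the circle. *)
Definition clamp x : R := Num.max (-1) (Num.min x 1).

Definition half_point x : R[i] := clamp x +i* Num.sqrt (1 - clamp x ^+ 2).

Definition lift_point x : R[i] := half_point x ^+ 2.

Definition peval p x : R[i] := (map_poly (real_complex R) p).[lift_point x].

Lemma conjcM (z z' : R[i]) : conjc (z * z') = conjc z * conjc z'.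
Proof. exact: rmorphM. Qed.

Lemma conjcD (z z' : R[i]) : conjc (z + z') = conjc z + conjc z'.
Proof. exact: rmorphD. Qed.

Lemma conjcX (z : R[i]) k : conjc (z ^+ k) = conjc z ^+ k.
Proof. exact: rmorphXn. Qed.

Lemma clamp_bounds x : -1 <= clamp x <= 1.
Proof. by rewrite /clamp le_max lexx /= ge_max ge_min lexx orbT andbT. Qed.

Lemma clamp_id x : -1 <= x <= 1 -> clamp x = x.
Proof. by move=> /andP[x1 x2]; rewrite /clamp min_l // max_r. Qed.

Lemma clampN x : clamp (- x) = - clamp x.
Proof.
rewrite /clamp; case: (leP (- x) 1) => ?; case: (leP x 1) => ?;
  by case: (leP (-1) (- x)) => ?; case: (leP (-1) x) => ?;
  case: (leP (-1) (1 : R)) => ?; lra.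
Qed.

Lemma half_point_conj x : half_point x * conjc (half_point x) = 1.
Proof.
rewrite /half_point; simpc; rewrite -!expr2 sqr_sqrtr; last first.
  have /andP[h1 h2] := clamp_bounds x.
  by rewrite subr_ge0 -[1](expr1n R 2) -subr_ge0 subr_sqr mulr_ge0; lra.
by congr (_ +i* _); ring.
Qed.

Lemma half_pointN x : half_point (- x) = - conjc (half_point x).
Proof.
rewrite /half_point clampN sqrrN; apply/eqP.
by rewrite eq_complex /= opprK !eqxx.
Qed.

(** This turns evenness on [[-1, 1]] into conjugation symmetry on the circle. *)
Lemma lift_pointN x : lift_point (- x) = conjc (lift_point x).
Proof. by rewrite /lift_point half_pointN sqrrN conjcX. Qed.

Lemma lift_point_conj x : lift_point x * conjc (lift_point x) = 1.
Proof. by rewrite /lift_point conjcX -exprMn half_point_conj expr1n. Qed.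

Lemma lift_point_neq0 x : lift_point x != 0.
Proof.
by apply/eqP => z0; have := lift_point_conj x; rewrite z0 mul0r => /eqP;
  rewrite eq_sym oner_eq0.
Qed.

Lemma pevalD p q x : peval (p + q) x = peval p x + peval q x.
Proof. by rewrite /peval rmorphD hornerD. Qed.

Lemma pevalM p q x : peval (p * q) x = peval p x * peval q x.
Proof. by rewrite /peval rmorphM hornerM. Qed.

Lemma pevalC (a : R) x : peval a%:P x = a%:C.
Proof. by rewrite /peval map_polyC hornerC. Qed.

Lemma pevalX x : peval 'X x = lift_point x.
Proof. by rewrite /peval map_polyX hornerX. Qed.

Lemma pevalXn k x : peval 'X^k x = lift_point x ^+ k.
Proof. by rewrite /peval map_polyXn hornerXn. Qed.

Lemma pevalZ (a : R) p x : peval (a *: p) x = a%:C * peval p x.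
Proof. by rewrite -mul_polyC pevalM pevalC. Qed.

Lemma horner_map_conj p (z : R[i]) :
  conjc (map_poly (real_complex R) p).[z] =
    (map_poly (real_complex R) p).[conjc z].
Proof.
elim/poly_ind: p => [|p c IH]; first by rewrite rmorph0 !horner0 conjc0.
rewrite !rmorphD !rmorphM /= map_polyX map_polyC !hornerE /=.
by rewrite conjcD conjcM IH conjc_real.
Qed.

Lemma peval_opp p x : peval p (- x) = conjc (peval p x).
Proof. by rewrite /peval lift_pointN horner_map_conj. Qed.

(** On the circle [1/z] is the conjugate of [z], and real coefficients let the conjugation pass
    outside the polynomial. *)
Lemma peval_rev j p x : (size p <= j.+1)%N ->
  peval (rev_poly j p) x = lift_point x ^+ j * conjc (peval p x).
Proof.
move=> sp; rewrite /peval map_rev_poly horner_rev_poly ?lift_point_neq0 //;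
  last first.
  by rewrite size_map_poly.
rewrite -[(map_poly _ _).[_^-1]]/((map_poly (real_complex R) p).[(lift_point
  x)^-1]).
rewrite horner_map_conj; congr (_ * _.[_]).
by apply: (mulfI (lift_point_neq0 x));
  rewrite mulfV ?lift_point_neq0 // lift_point_conj.
Qed.

(** Keeping only the real part loses nothing for even weights: the imaginary part is odd in [x] and
    integrates to 0 ([Rintegral_hermi]). *)
Definition herm p q x : R := complex.Re (peval p x * conjc (peval q x)).

Lemma Re_conj (z : R[i]) : complex.Re (conjc z) = complex.Re z.
Proof. by case: z. Qed.

Lemma Re_add (z z' : R[i]) : complex.Re (z + z') = complex.Re z + complex.Re z'.
Proof. by case: z z' => [? ?] []. Qed.

Lemma Re_scale (a : R) (z : R[i]) : complex.Re (a%:C * z) = a * complex.Re z.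
Proof. by case: z => ? ?; simpc. Qed.

Lemma hermDl p1 p2 q x : herm (p1 + p2) q x = herm p1 q x + herm p2 q x.
Proof. by rewrite /herm pevalD mulrDl Re_add. Qed.

Lemma hermZl (a : R) p q x : herm (a *: p) q x = a * herm p q x.
Proof. by rewrite /herm pevalZ -mulrA Re_scale. Qed.

Lemma hermC p q x : herm p q x = herm q p x.
Proof. by rewrite /herm -Re_conj conjcM conjcK mulrC. Qed.

Lemma hermX p q x : herm ('X * p) ('X * q) x = herm p q x.
Proof.
rewrite /herm !pevalM pevalX conjcM; congr (complex.Re _).
by rewrite mulrACA lift_point_conj mul1r.
Qed.

(** The unimodular factors [z^j] cancel, and the remaining conjugation does not affect the real
    part. *)
Lemma herm_rev j p q x : (size p <= j.+1)%N -> (size q <= j.+1)%N ->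
  herm (rev_poly j p) (rev_poly j q) x = herm p q x.
Proof.
move=> sp sq; rewrite /herm !peval_rev //
  !conjcM (conjcX (lift_point x)) conjcK.
by rewrite mulrACA -exprMn lift_point_conj expr1n mul1r -Re_conj conjcM conjcK.
Qed.

Lemma clamp_continuous : continuous clamp.
Proof.
move=> x; apply: (@continuous_max R R (cst (-1)) (fun x => Num.min x 1)).
  exact: cvg_cst.
apply: (@continuous_min R R id (cst 1)); [exact: cvg_id|exact: cvg_cst].
Qed.

Lemma lift_point_continuous :
  continuous (fun x => complex.Re (lift_point x)) /\ continuous (fun x =>
    complex.Im (lift_point x)).
Proof.
have cc := clamp_continuous.
have cs : continuous (fun x => Num.sqrt (1 - clamp x ^+ 2)).
  move=> x; apply: (@continuous_comp _ _ _ (fun x => 1 - clamp x ^+ 2)).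
    apply: cvgB; first exact: cvg_cst.
    by apply: cvgM; exact: cc.
  exact: sqrt_continuous.
split=> x.
- have -> : (fun x => complex.Re (lift_point x)) =
      (fun x => clamp x * clamp x - Num.sqrt (1 - clamp x ^+ 2) * Num.sqrt (1 -
        clamp x ^+ 2)).
    by apply/funext => y /=; rewrite /lift_point /half_point expr2; simpc.
  by apply: cvgB; apply: cvgM; [exact: cc|exact: cc|exact: cs|exact: cs].
- have -> : (fun x => complex.Im (lift_point x)) =
      (fun x => clamp x * Num.sqrt (1 - clamp x ^+ 2) + Num.sqrt (1 - clamp x
        ^+ 2) * clamp x).
    by apply/funext => y /=; rewrite /lift_point /half_point expr2; simpc.
  by apply: cvgD; apply: cvgM; [exact: cc|exact: cs|exact: cs|exact: cc].
Qed.

Lemma peval_continuous p :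
  continuous (fun x => complex.Re (peval p x)) /\
  continuous (fun x => complex.Im (peval p x)).
Proof.
have [cr ci] := lift_point_continuous.
elim/poly_ind: p => [|p c [IHr IHi]].
  by split=> x; rewrite /peval rmorph0; under eq_fun do rewrite horner0;
    exact: cvg_cst.
split=> x.
- have -> : (fun x => complex.Re (peval (p * 'X + c%:P) x)) = (fun x =>
      complex.Re (peval p x) * complex.Re (lift_point x) -
      complex.Im (peval p x) * complex.Im (lift_point x) + c).
    apply/funext => y; rewrite pevalD pevalM pevalX pevalC.
    by case: (peval p y) (lift_point y) => [a b] [a' b']; simpc.
  apply: cvgD; last exact: cvg_cst.
  by apply: cvgB; apply: cvgM; [exact: IHr|exact: cr|exact: IHi|exact: ci].
- have -> : (fun x => complex.Im (peval (p * 'X + c%:P) x)) = (fun x =>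
      complex.Re (peval p x) * complex.Im (lift_point x) +
      complex.Im (peval p x) * complex.Re (lift_point x)).
    apply/funext => y; rewrite pevalD pevalM pevalX pevalC.
    by case: (peval p y) (lift_point y) => [a b] [a' b']; simpc.
  by apply: cvgD; apply: cvgM; [exact: IHr|exact: ci|exact: IHi|exact: cr].
Qed.

Lemma herm_continuous p q : continuous (herm p q).
Proof.
have [pr pi] := peval_continuous p; have [qr qi] := peval_continuous q.
have -> : herm p q = (fun x =>
    complex.Re (peval p x) * complex.Re (peval q x) +
    complex.Im (peval p x) * complex.Im (peval q x)).
  apply/funext => y; rewrite /herm.
  by case: (peval p y) (peval q y) => [a b] [a' b']; simpc.
move=> x; apply: cvgD; apply: cvgM;
  [exact: pr|exact: qr|exact: pi|exact: qi].
Qed.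

End Circle.

(** * The inner product of an even weight *)

Section Form.
Variable R : realType.
Implicit Types (p q : {poly R}) (x : R) (w f g : R -> R).
Local Notation mu := (@lebesgue_measure R).

Lemma integrable_segment f : {within `[-1, 1], continuous f} ->
  mu.-integrable `[-1, 1] (EFin \o f).
Proof. by move=> cf; apply: continuous_compact_integrable => //;
  exact: segment_compact. Qed.

Lemma within_continuousM (A : set R) f g : {within A, continuous f} ->
  {within A, continuous g} -> {within A, continuous (fun x => f x * g x)}.
Proof. by move=> cf cg x; apply: cvgM; [exact: cf|exact: cg]. Qed.

Lemma within_herm w p q : {within `[-1, 1], continuous w} ->
  {within `[-1, 1], continuous (fun x => herm p q x * w x)}.
Proof.
move=> cw; apply: within_continuousM => //.
exact/continuous_subspaceT/herm_continuous.
Qed.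

Definition form w p q : R := \int[mu]_(x in `[-1, 1]) (herm p q x * w x).

Lemma formC w p q : form w p q = form w q p.
Proof. by apply: eq_Rintegral => x _; rewrite hermC. Qed.

Lemma formX w p q : form w ('X * p) ('X * q) = form w p q.
Proof. by apply: eq_Rintegral => x _; rewrite hermX. Qed.

Lemma form_rev w j p q : (size p <= j.+1)%N -> (size q <= j.+1)%N ->
  form w (rev_poly j p) (rev_poly j q) = form w p q.
Proof. by move=> sp sq; apply: eq_Rintegral => x _; rewrite herm_rev. Qed.

Lemma form_scalew (a : R) w p q : {within `[-1, 1], continuous w} ->
  form (fun x => a * w x) p q = a * form w p q.
Proof.
move=> cw; rewrite /form -RintegralZl //;
  last exact/integrable_segment/within_herm.
by apply: eq_Rintegral => x _; rewrite mulrCA.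
Qed.

Lemma form_subw w1 w2 p q : {within `[-1, 1], continuous w1} ->
  {within `[-1, 1], continuous w2} ->
  form (fun x => w1 x - w2 x) p q = form w1 p q - form w2 p q.
Proof.
move=> c1 c2; rewrite /form -RintegralB //;
  [|exact/integrable_segment/within_herm..].
by apply: eq_Rintegral => x _; rewrite mulrBr.
Qed.

Section Linear.
Variable w : R -> R.
Hypothesis cw : {within `[-1, 1], continuous w}.

Lemma formDl p1 p2 q : form w (p1 + p2) q = form w p1 q + form w p2 q.
Proof.
rewrite /form -RintegralD //; [|exact/integrable_segment/within_herm..].
by apply: eq_Rintegral => x _; rewrite hermDl mulrDl.
Qed.

Lemma formZl (a : R) p q : form w (a *: p) q = a * form w p q.
Proof.
rewrite /form -RintegralZl //; last exact/integrable_segment/within_herm.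
by apply: eq_Rintegral => x _; rewrite hermZl mulrA.
Qed.

Lemma formNl p q : form w (- p) q = - form w p q.
Proof. by rewrite -scaleN1r formZl mulN1r. Qed.

Lemma formBl p1 p2 q : form w (p1 - p2) q = form w p1 q - form w p2 q.
Proof. by rewrite formDl formNl. Qed.

Lemma formBr p q1 q2 : form w p (q1 - q2) = form w p q1 - form w p q2.
Proof. by rewrite formC formBl !(formC _ _ p). Qed.

Lemma form0l q : form w 0 q = 0.
Proof. by rewrite -(scale0r 0) formZl mul0r. Qed.

Lemma form_suml (n : nat) (F : 'I_n -> {poly R}) q :
  form w (\sum_i F i) q = \sum_i form w (F i) q.
Proof.
by apply: (big_morph (fun p => form w p q)) => [p1 p2|];
  [exact: formDl|exact: form0l].
Qed.

Lemma form_coefl (n : nat) p q : (size p <= n)%N ->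
  form w p q = \sum_(i < n) p`_i * form w 'X^i q.
Proof.
move=> sp; rewrite -{1}[p](coefK p) (poly_def (size p)).
rewrite [in LHS](_ : \sum_(i < size p) _ = \sum_(i < n) p`_i *: 'X^i);
  last first.
  rewrite (big_ord_widen n (fun i => p`_i *: 'X^i)) // big_mkcond.
  apply: eq_bigr => i _; case: ifPn => //; rewrite -leqNgt => pi.
  by rewrite nth_default // scale0r.
by rewrite form_suml; apply: eq_bigr => i _; rewrite formZl.
Qed.

Lemma form_orth (n : nat) p q :
  (forall k, (k < n)%N -> form w p 'X^k = 0) -> (size q <= n)%N ->
  form w p q = 0.
Proof.
move=> pq sq; rewrite formC (form_coefl _ sq) big1 // => i _.
by rewrite formC pq // mulr0.
Qed.

End Linear.

(** The integrand is nonnegative on [[-1, 1]], so restricting it to a subinterval can only lower the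
    integral. *)
Lemma le_form_interval w p (a b e : R) : {within `[-1, 1], continuous w} ->
  (forall x, x \in `[-1, 1] -> 0 < w x) ->
  -1 <= a -> a <= b -> b <= 1 ->
  (forall x, x \in `[a, b] -> e <= herm p p x * w x) ->
  e * (b - a) <= form w p p.
Proof.
move=> cw w0 a1 ab b1 he.
have sub : `[a, b] `<=` `[-1, 1] by apply: subset_itv; rewrite bnd_simp.
have int1 := integrable_segment (@within_herm w p p cw).
have int2 : mu.-integrable `[a, b] (EFin \o (fun x => herm p p x * w x)).
  exact: integrableS int1.
apply: (@le_trans _ _ (\int[mu]_(x in `[a, b]) (herm p p x * w x))).
  have -> : e * (b - a) = \int[mu]_(x in `[a, b]) e.
    rewrite Rintegral_cst //; congr (_ * _).
    have muab : mu `[a, b] = (b - a)%:E.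
      rewrite lebesgue_measure_itv /= lte_fin.
      case: ltP => [_|ba]; first by rewrite EFinB.
      by have -> : b - a = 0 by lra.
    by rewrite -[LHS]/(fine (b - a)%:E) -muab.
  apply: le_Rintegral => //.
  apply: continuous_compact_integrable; first exact: segment_compact.
  by apply: continuous_subspaceT => x; exact: cvg_cst.
have h0 x : x \in `[-1, 1] -> 0 <= herm p p x * w x.
  move=> xI; rewrite mulr_ge0 ?(ltW (w0 _ xI)) // /herm.
  by case: (peval p x) => c d; simpc; rewrite -!expr2 addr_ge0 ?sqr_ge0.
rewrite /form /Rintegral fine_le ?integrable_fin_num //.
apply: ge0_subset_integral => //; first by case/integrableP : int1.
Qed.

(** Otherwise [p] would vanish at all the points [lift_point (1/(k+2))]. These are distinct, since
    their real parts [2 x^2 - 1] are injective in [x >= 0], and [size p] of them already exceed the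
    possible number of roots. *)
Lemma exists_peval_neq0 p : p != 0 ->
  exists2 x : R, -1 < x < 1 & peval p x != 0.
Proof.
move=> p0; apply: contrapT => H.
have pz k : root (map_poly (real_complex R) p) (lift_point (k.+2%:R^-1 : R)).
  apply: contraPT H => rk H; apply: H; exists (k.+2%:R^-1) => //.
  apply/andP; split.
    by rewrite (@lt_le_trans _ _ 0) // ltrN10.
  by rewrite invf_lt1 // ltr1n.
have inj : injective (fun k => lift_point (k.+2%:R^-1 : R)).
  move=> k l; have b (m : nat) : 0 <= (m.+2%:R^-1 : R) <= 1.
    by rewrite invr_ge0 ler0n invf_le1 // ler1n.
  have ec (m : nat) : complex.Re (lift_point (m.+2%:R^-1 : R)) =
    2 * m.+2%:R^-1 ^+ 2 - 1.
    move: (m.+2%:R^-1) (b m) => r /andP[b1 b2].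
    rewrite /lift_point /half_point clamp_id; last by apply/andP; split; lra.
    rewrite expr2; simpc; rewrite -!expr2 sqr_sqrtr; first by rewrite /=; ring.
    by rewrite subr_ge0 exprn_ile1.
  have two0 : 2 != 0 :> R by rewrite pnatr_eq0.
  move=> /(congr1 (@complex.Re R)); rewrite !ec => /addIr /(mulfI two0) /eqP.
  rewrite eqrXn2 ?invr_ge0 ?ler0n // (can_eq (@invrK R)) eqr_nat.
  by move=> /eqP [].
have := @max_poly_roots _ (map_poly (real_complex R) p)
  [seq lift_point (k.+2%:R^-1 : R) | k <- iota 0 (size p)].
rewrite map_poly_eq0 => /(_ p0); rewrite size_map size_iota size_map_poly ltnn.
move=> H2; suff: false by []; apply: H2.
- by apply/allP => _ /mapP[k _ ->]; exact: pz.
- by rewrite map_inj_uniq ?iota_uniq.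
Qed.

(** Near an interior point where [p] does not vanish, the integrand stays above half of its positive
    value there. *)
Lemma form_gt0 w p : {within `[-1, 1], continuous w} ->
  (forall x, x \in `[-1, 1] -> 0 < w x) -> p != 0 -> 0 < form w p p.
Proof.
move=> cw w0 /exists_peval_neq0[x x1 px].
have xI : x \in `[-1, 1] by rewrite in_itv /=; case/andP: x1 => *; apply/andP;
  split; lra.
pose g y := herm p p y * w y.
have g0 : 0 < g x.
  rewrite mulr_gt0 ?w0 // /herm.
  case: (peval p x) px => c d; rewrite eq_complex /= negb_and => cd; simpc.
  rewrite -!expr2 lt_def addr_ge0 ?sqr_ge0 // andbT.
  by rewrite paddr_eq0 ?sqr_ge0 // !sqrf_eq0 negb_and.
have cg : {for x, continuous g}.
  have cg0 : {within `[-1, 1], continuous g} by exact: within_herm.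
  have : {within `]-1, 1[, continuous g}.
    by apply: continuous_subspaceW cg0; exact: subset_itv_oo_cc.
  rewrite continuous_open_subspace; last exact: interval_open.
  by apply; rewrite inE.
have [e e0 he] : exists2 e : R, 0 < e & forall y, `|x - y| < e -> g x / 2 < g y.
  have /cvgrPdist_lt /(_ (g x / 2)) := cg.
  have -> : 0 < g x / 2 by lra.
  move=> /(_ isT) [e /= e0 he]; exists e => // y /he /=.
  by rewrite ltr_distl => /andP[]; lra.
(* The radius is small enough for the lower bound and for [[x - d, x + d]] to stay inside
   [[-1, 1]]. *)
pose d := Num.min (e / 2) (Num.min (1 - x) (x + 1)).
have [d0 de dx1 dx2] : [/\ 0 < d, d <= e / 2, d <= 1 - x & d <= x + 1].
  case/andP: x1 => x1 x2; rewrite /d !lt_min !ge_min !lexx ?orbT.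
  by split => //; apply/and3P; split; lra.
have := @le_form_interval w p (x - d) (x + d) (g x / 2) cw w0.
have -> : x + d - (x - d) = 2 * d by ring.
move=> H; apply: lt_le_trans (H _ _ _ _); [|lra|lra|lra|].
  by rewrite mulr_gt0 //; lra.
move=> y; rewrite in_itv /= => /andP[y1 y2]; apply/ltW/he.
by rewrite ltr_norml; apply/andP; split; lra.
Qed.

(** With bounded degrees, the form is a fixed finite sum of products of coefficients and forms of
    monomials. *)
Lemma form_cvg (T : Type) (F : set_system T) (FF : Filter F)
    (w : T -> R -> R) (w0 : R -> R) (p q : T -> {poly R}) (p0 q0 : {poly R})
    (n : nat) :
  (forall t, {within `[-1, 1], continuous (w t)}) ->
  {within `[-1, 1], continuous w0} ->
  (forall t, (size (p t) <= n)%N) -> (forall t, (size (q t) <= n)%N) ->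
  (size p0 <= n)%N -> (size q0 <= n)%N ->
  (forall i, (p t)`_i @[t --> F] --> p0`_i) ->
  (forall i, (q t)`_i @[t --> F] --> q0`_i) ->
  (forall r s, form (w t) r s @[t --> F] --> form w0 r s) ->
  form (w t) (p t) (q t) @[t --> F] --> form w0 p0 q0.
Proof.
move=> cw cw0 sp sq sp0 sq0 cp cq cf.
have E (v : R -> R) (r s : {poly R}) : {within `[-1, 1], continuous v} ->
  (size r <= n)%N -> (size s <= n)%N ->
    form v r s = \sum_(i < n) \sum_(k < n) r`_i * (s`_k * form v 'X^k 'X^i).
  move=> cv sr ss; rewrite (form_coefl cv _ sr); apply: eq_bigr => i _.
  by rewrite formC (form_coefl cv _ ss) mulr_sumr.
rewrite E //; under eq_fun do rewrite E //.
do 2 (apply: cvg_big => [|? _]; first exact: add_continuous).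
by apply: cvgM => //; apply: cvgM.
Qed.

(** * Exponential weights and their first variation *)

Section Exponential.
Variable B : R -> R.
Hypothesis cB : {within `[-1, 1], continuous B}.

Definition tilt (t x : R) : R := expR (t * B x).

Lemma tilt_continuous (t : R) : {within `[-1, 1], continuous (tilt t)}.
Proof.
move=> x; apply: continuous_cvg; first exact: continuous_expR.
by apply: cvgM; [exact: cvg_cst|exact: cB].
Qed.

Lemma tilt_gt0 (t x : R) : 0 < tilt t x.
Proof. exact: expR_gt0. Qed.

Lemma tilt0 : tilt 0 = cst 1.
Proof. by apply/funext => x; rewrite /tilt mul0r expR0. Qed.

(** Differentiation under the integral sign at [t = 0]. *)
Lemma form_tilt_quotient p q :
  h^-1 * (form (tilt h) p q - form (tilt 0) p q) @[h --> 0^'] --> form B p q.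
Proof.
pose f (t x : R) := herm p q x * tilt t x.
have d1f t x : is_derive t (1 : R) (f ^~ x) (herm p q x * (B x * tilt t x)).
  rewrite /f /tilt; apply: is_derive_eq.
  by rewrite scaler0 add0r /GRing.scale /= mulr1; ring.
have d1E t x : derive1 (f ^~ x) t = herm p q x * (B x * tilt t x).
  by rewrite derive1E; exact: derive_val.
(* This function dominates the [t]-derivative of the integrand for [|t| < 1]. *)
have wc : {within `[-1, 1], continuous (fun x =>
  `|herm p q x * B x| * expR `|B x|)}.
  move=> x; apply: cvgM.
    apply: cvg_norm; apply: cvgM; last exact: cB.
    exact/continuous_subspaceT/herm_continuous.
  apply: continuous_cvg; first exact: continuous_expR.
  by apply: cvg_norm; exact: cB.
have := @cvg_differentiation_under_integral R _ _ mu f `[-1, 1] _ 0 (-1) 1 _ _ _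
  (fun x => `|herm p q x * B x| * expR `|B x|).
rewrite /partial1of2.
under [X in _ --> X]eq_Rintegral do rewrite d1E.
have -> : \int[mu]_(x in `[-1, 1]) (herm p q x * (B x * tilt 0 x)) = form B p q.
  by apply: eq_Rintegral => x _; rewrite tilt0 mulr1.
move=> H; under eq_fun => h do rewrite -[h in form (tilt h)]addr0.
apply: H => //.
- by rewrite /= in_itv /= ltrN10 ltr01.
- by move=> t _; exact/integrable_segment/within_herm/tilt_continuous.
- exact: integrable_segment.
- move=> t x; rewrite /= in_itv /= => /andP[t1 t2] _.
  rewrite d1E mulrA normrM ler_wpM2l //.
  rewrite (ger0_norm (ltW (tilt_gt0 t x))) ler_expR (le_trans (ler_norm _)) //.
  by rewrite normrM ler_piMl // ler_norml; apply/andP; split; exact: ltW.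
Qed.

(** The increment is [h] times a convergent difference quotient. *)
Lemma form_tilt_cvg p q : form (tilt t) p q @[t --> 0^'] --> form (tilt 0) p q.
Proof.
have H : h^-1 * (form (tilt h) p q - form (tilt 0) p q) @[h --> 0^'] --> form B
  p q.
  exact: form_tilt_quotient.
have : h * (h^-1 * (form (tilt h) p q - form (tilt 0) p q)) + form (tilt 0) p q
    @[h --> 0^'] --> 0 * form B p q + form (tilt 0) p q.
  apply: cvgD; last exact: cvg_cst.
  by apply: cvgM H; exact: nbhs_dnbhs.
rewrite mul0r add0r; apply: cvg_trans; apply: near_eq_cvg.
near=> h; rewrite mulrA mulfV ?mul1r ?subrK //.
by near: h; exact: nbhs_dnbhs_neq.
Unshelve. all: end_near. Qed.

End Exponential.
End Form.

(** * The Szego recursion and its first-order perturbation *)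

Lemma size_sub_monic (R : nzRingType) (p q : {poly R}) (j : nat) :
  p \is monic -> q \is monic -> size p = j.+1 -> size q = j.+1 ->
  (size (p - q)%R <= j)%N.
Proof.
move=> pm qm sp sq; apply/leq_sizeP => i; rewrite leq_eqVlt => /predU1P[<-|ji].
  move: pm qm; rewrite !monicE !lead_coefE sp sq /= coefB.
  by move=> /eqP -> /eqP ->; rewrite subrr.
by rewrite coefB !nth_default ?subrr // ?sp ?sq.
Qed.

Section Szego.
Variable R : realType.
Implicit Types (p q : {poly R}) (w v : R -> R).

(** The coefficient is the one that makes the new polynomial orthogonal to [1]: the pairing of the
    reversed polynomial with [1] equals the denominator ([form_rev_szego1]). *)
Fixpoint szego w (n : nat) : {poly R} :=
  if n is j.+1 then
    'X * szego w j -
      (form w ('X * szego w j) 1 / form w (szego w j) (szego w j)) *: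
        rev_poly j (szego w j)
  else 1.

Definition reflection w (j : nat) : R :=
  form w ('X * szego w j) 1 / form w (szego w j) (szego w j).

Lemma szegoS w j :
  szego w j.+1 = 'X * szego w j - reflection w j *: rev_poly j (szego w j).
Proof. by []. Qed.

Lemma szego0 w : szego w 0 = 1.
Proof. by []. Qed.

Arguments szego : simpl never.

Lemma szego_size w j : size (szego w j) = j.+1 /\ szego w j \is monic.
Proof.
elim: j => [|j [IHs IHm]]; first by rewrite szego0 size_poly1 monic1.
have sX : size ('X * szego w j) = j.+2.
  by rewrite mulrC size_mulX ?IHs // monic_neq0.
have slt : (size (- (reflection w j *: rev_poly j (szego w j)))%R < size ('X *
  szego w j)%R)%N.
  by rewrite size_polyN sX ltnS (leq_trans (size_scale_leq _ _)) ?size_rev_poly.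
rewrite szegoS size_polyDl // sX; split => //.
by rewrite monicE lead_coefDl // lead_coef_Mmonic ?lead_coefX // .
Qed.

Lemma size_szego w j : size (szego w j) = j.+1.
Proof. by have [] := szego_size w j. Qed.

Lemma szego_monic w j : szego w j \is monic.
Proof. by have [] := szego_size w j. Qed.

(** The constant coefficient of the reversed polynomial is the leading coefficient 1 of the monic
    one. *)
Lemma szego_coef0 w j : (szego w j.+1)`_0 = - reflection w j.
Proof.
rewrite szegoS coefB coefXM sub0r coefZ coef_rev_poly subn0 /=.
have := szego_monic w j; rewrite monicE lead_coefE size_szego => /eqP ->.
by rewrite mulr1.
Qed.

Lemma size_szego_subXn w j : (size (szego w j - 'X^j)%R <= j)%N.
Proof.
by apply: size_sub_monic;
  rewrite ?szego_monic ?monicXn ?size_szego ?size_polyXn.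
Qed.

(** * Orthogonality, norms and uniqueness for a positive weight *)

Section Weight.
Variable w : R -> R.
Hypothesis cw : {within `[-1, 1], continuous w}.
Hypothesis w_gt0 : forall x : R, x \in `[-1, 1] -> 0 < w x.
Local Notation s := (szego w).
Local Notation a := (reflection w).

Lemma szego_norm_gt0 j : 0 < form w (s j) (s j).
Proof. by apply: form_gt0 => //; rewrite monic_neq0 // szego_monic. Qed.

(** ['X^k] is the reversal of ['X^(j - k)], and reversal preserves the form. *)
Lemma form_rev_szego_Xn j k : (k <= j)%N ->
  form w (rev_poly j (s j)) 'X^k = form w (s j) 'X^(j - k).
Proof.
move=> kj; rewrite -[in LHS](subKn kj) -rev_poly_Xn ?leq_subr //.
by rewrite form_rev ?size_szego // size_polyXn ltnS leq_subr.
Qed.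

(** Induction on [j]. For [k >= 1] both terms of the recursion reduce to pairings of the [j]-th
    polynomial with ['X^(k-1)] and ['X^(j-k)], which vanish; for [k = 0] the choice of the
    coefficient gives 0. *)
Lemma szego_orth j k : (k < j)%N -> form w (s j) 'X^k = 0.
Proof.
elim: j k => // j IH k; rewrite ltnS => kj.
have top : form w (s j) 'X^j = form w (s j) (s j).
  apply/esym/eqP; rewrite -subr_eq0 -formBr //; apply/eqP.
  exact: (form_orth cw IH (size_szego_subXn w j)).
rewrite szegoS formBl // formZl // form_rev_szego_Xn //.
case: k kj => [|k] kj.
  by rewrite subn0 top expr0 /reflection divfK ?subrr // gt_eqF //
    szego_norm_gt0.
rewrite exprS formX IH // IH ?mulr0 ?subrr //.
by rewrite ltn_subrL /= (leq_ltn_trans _ kj).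
Qed.

Lemma form_szego_Xn j : form w (s j) 'X^j = form w (s j) (s j).
Proof.
apply/esym/eqP; rewrite -subr_eq0 -formBr //; apply/eqP.
exact: (form_orth cw (@szego_orth j) (size_szego_subXn w j)).
Qed.

Lemma form_rev_szego1 j : form w (rev_poly j (s j)) 1 = form w (s j) (s j).
Proof. by rewrite -(expr0 'X) form_rev_szego_Xn // subn0 form_szego_Xn. Qed.

(** Pair the recursion with ['X^(j+1)]. Reversal in degree [j+1] turns the pairing of the reversed
    polynomial with ['X^(j+1)] into that of ['X * s j] with [1], the numerator of [a j]. *)
Lemma szego_normS j :
  form w (s j.+1) (s j.+1) = (1 - a j ^+ 2) * form w (s j) (s j).
Proof.
rewrite -form_szego_Xn [in LHS]szegoS formBl // formZl //
  exprS formX form_szego_Xn.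
have -> : form w (rev_poly j (s j)) ('X * 'X^j) = a j * form w (s j) (s j).
  have -> : 'X * 'X^j = rev_poly j.+1 (1 : {poly R}).
    by rewrite -(expr0 'X) rev_poly_Xn // subn0 exprS.
  rewrite -(form_rev _ (j := j.+1)) ?(leq_trans (size_rev_poly _ _))
    ?size_poly1 //.
  rewrite rev_polyK ?size_szego //.
  have -> : rev_poly j.+1 (rev_poly j.+1 1) = 1 :> {poly R}.
    by rewrite -(expr0 'X) !rev_poly_Xn // ?subn0 ?subnn // subnn expr0.
  by rewrite /reflection divfK // gt_eqF // szego_norm_gt0.
by ring.
Qed.

(** Such a [p] is orthogonal to itself, which positivity forbids unless it is 0. *)
Lemma orth_size_eq0 p j : (size p <= j)%N ->
  (forall k, (k < j)%N -> form w p 'X^k = 0) -> p = 0.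
Proof.
move=> sp po; apply/eqP; apply: contraT => p0.
by have := form_gt0 cw w_gt0 p0; rewrite (form_orth cw po sp) ltxx.
Qed.

Lemma szego_unique p j : p \is monic -> size p = j.+1 ->
  (forall k, (k < j)%N -> form w p 'X^k = 0) -> p = s j.
Proof.
move=> pm sp po; apply/eqP; rewrite -subr_eq0; apply/eqP.
apply: (@orth_size_eq0 _ j) => [|k kj].
  by apply: size_sub_monic; rewrite ?szego_monic ?size_szego.
by rewrite formBl // po // szego_orth // subrr.
Qed.

End Weight.

(* Testing the orthogonality of the (n+1)-st polynomial of v against the
   reversed n-th polynomial of w isolates its constant term, which is minus the
   reflection coefficient. *)
Lemma reflection_perturb v w n :
  {within `[-1, 1], continuous v} -> {within `[-1, 1], continuous w} ->
  (forall x : R, x \in `[-1, 1] -> 0 < v x) ->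
  (forall x : R, x \in `[-1, 1] -> 0 < w x) ->
  (reflection v n - reflection w n) * form w (szego w n) (szego w n) =
    form (fun x => v x - w x) (szego v n.+1) (rev_poly n (szego w n)).
Proof.
move=> cv cw v0 w0; rewrite form_subw //.
(* The reversed polynomial has degree at most [n], so its pairing under [v] with the polynomial of
   degree [n+1] vanishes. *)
rewrite (form_orth cv (@szego_orth _ cv v0 n.+1) (size_rev_poly _ _)) sub0r.
have o := form_orth cw (@szego_orth _ cw w0 n.+1) (size_rev_poly n (szego w n)).
have sD : (size (szego v n.+1 - szego w n.+1)%R <= n.+1)%N.
  by apply: size_sub_monic; rewrite ?szego_monic ?size_szego.
have : form w (szego v n.+1 - szego w n.+1) (rev_poly n (szego w n)) =
    form w (szego v n.+1) (rev_poly n (szego w n)).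
  by rewrite formBl // o subr0.
(* Under [w] the reversed polynomial is orthogonal to ['X], ..., ['X^n]; only the constant
   coefficient survives. *)
rewrite (form_coefl cw _ sD) big_ord_recl /= big1 => [|i _]; last first.
  rewrite formC form_rev_szego_Xn // szego_orth ?mulr0 //.
  by rewrite /bump leq0n add1n ltn_subrL /= (leq_ltn_trans _ (ltn_ord i)).
rewrite addr0 expr0 formC form_rev_szego1 // coefB !szego_coef0 => <-.
by ring.
Qed.

(** * Derivative of the reflection coefficients along exponential weights *)

Section Response.
Variable B : R -> R.
Hypothesis cB : {within `[-1, 1], continuous B}.
Let w (t : R) := tilt B t.
Let cw t : {within `[-1, 1], continuous (w t)}.
Proof. exact: tilt_continuous. Qed.
Let w0 t (x : R) : x \in `[-1, 1] -> 0 < w t x.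
Proof. by move=> _; exact: tilt_gt0. Qed.

Let N0 j : form (w 0) (szego (w 0) j) (szego (w 0) j) != 0.
Proof. by rewrite gt_eqF // (szego_norm_gt0 (@cw 0) (@w0 0)). Qed.

(** Induction along the recursion: the reflection coefficient is a quotient of convergent forms with
    nonzero limiting denominator. *)
Lemma szego_coef_cvg j i : (szego (w t) j)`_i @[t --> 0^'] --> (szego (w 0)
  j)`_i.
Proof.
elim: j i => [|j IH] i.
  by rewrite szego0; under eq_fun do rewrite szego0; exact: cvg_cst.
have cX k : ('X * szego (w t) j)`_k @[t --> 0^'] --> ('X * szego (w 0) j)`_k.
  rewrite coefXM; under eq_fun do rewrite coefXM.
  by case: k => [|k] /=; [exact: cvg_cst|exact: IH].
have sX t : (size ('X * szego (w t) j)%R <= j.+2)%N.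
  by rewrite mulrC (leq_trans (size_polyMleq _ _)) //
    size_szego size_polyX addn2.
have s2 t : (size (szego (w t) j) <= j.+2)%N by rewrite size_szego.
have s1 : (size (1%R : {poly R}) <= j.+2)%N by rewrite size_poly1.
have cf r s : form (w t) r s @[t --> 0^'] --> form (w 0) r s.
  exact: form_tilt_cvg.
have ca : reflection (w t) j @[t --> 0^'] --> reflection (w 0) j.
  apply: cvgM; last apply: cvgV => //.
  - apply: (@form_cvg _ _ _ _ w (w 0) _ (fun=> 1) _ 1 j.+2) => // k.
    exact: cvg_cst.
  - exact: (@form_cvg _ _ _ _ w (w 0) _ _ _ _ j.+2).
rewrite szegoS coefB coefZ coef_rev_poly.
under eq_fun do rewrite szegoS coefB coefZ coef_rev_poly.
apply: cvgB; first exact: cX.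
apply: cvgM => //.
by case: ifP => _; [exact: IH|exact: cvg_cst].
Qed.

(** Divide [reflection_perturb] for [w h] and [w 0] by [h]. The weight difference already carries
    the first order in [h], so convergence of the coefficients of [szego (w h) n.+1] suffices. *)
Lemma reflection_derivative n :
  h^-1 * (reflection (w h) n - reflection (w 0) n) @[h --> 0^'] -->
    form B (szego (w 0) n.+1) (rev_poly n (szego (w 0) n)) /
      form (w 0) (szego (w 0) n) (szego (w 0) n).
Proof.
have cq h : {within `[-1, 1], continuous (fun x => w h x - w 0 x)}.
  by move=> x; apply: cvgB; [exact: (@cw h)|exact: (@cw 0)].
have E h : h^-1 * (reflection (w h) n - reflection (w 0) n) =
    form (fun x => h^-1 * (w h x - w 0 x)) (szego (w h) n.+1)
      (rev_poly n (szego (w 0) n)) / form (w 0) (szego (w 0) n) (szego (w 0) n).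
  by rewrite form_scalew //
    -(reflection_perturb n (@cw h) (@cw 0) (@w0 h) (@w0 0)) -mulrA mulfK.
under eq_fun do rewrite E.
apply: cvgM; last exact: cvg_cst.
apply: (@form_cvg _ _ _ _ _ B _ (fun=> rev_poly n (szego (w 0) n)) _ _ n.+2) =>
  //.
- move=> h; apply: within_continuousM => //; move=> x; exact: cvg_cst.
- by move=> h; rewrite size_szego.
- by move=> h; rewrite (leq_trans (size_rev_poly _ _)).
- by rewrite size_szego.
- by rewrite (leq_trans (size_rev_poly _ _)).
- by move=> i; exact: szego_coef_cvg.
- by move=> i; exact: cvg_cst.
- move=> r s.
  under eq_fun do rewrite form_scalew // form_subw //.
  exact: form_tilt_quotient.
Qed.

End Response.
End Szego.

Arguments szego : simpl never.

(** * The constant weight *)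

Section LegendreWeight.
Variable R : realType.
Implicit Types (x : R) (n m : nat) (q : {poly R}).
Local Notation mu := (@lebesgue_measure R).
Local Notation P := (legendre R).
Local Open Scope complex_scope.

Lemma Rintegral_deriv q :
  \int[mu]_(x in `[-1, 1]) (q^`().[x]) = q.[1] - q.[-1].
Proof.
rewrite /Rintegral (@continuous_FTC2 _ _ (horner q)).
- by rewrite -EFinB.
- by lra.
- by apply: continuous_subspaceT => x; exact: continuous_horner.
- split.
  + by move=> x _; exact: derivable_horner.
  + by apply: cvg_at_right_filter; exact: continuous_horner.
  + by apply: cvg_at_left_filter; exact: continuous_horner.
- by move=> x _; rewrite -derivE.
Qed.

Lemma legendre_op_horner q x :
  legendre_op (horner q) x = (- ((1 - 'X^2) * q^`())^`()).[x].
Proof.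
rewrite /legendre_op hornerN; congr (- _).
rewrite (_ : (fun y => _) = horner ((1 - 'X^2) * q^`())) -?derivE //.
by apply/funext => y; rewrite !hornerE.
Qed.

(* half_point x ^+ m = T_m(x) + i sqrt (1 - x^2) U_(m-1)(x), with the Chebyshev
   polynomials T_m and U_(m-1). *)
Fixpoint chebyshev m : {poly R} * {poly R} :=
  if m is k.+1 then
    let: (t, u) := chebyshev k in ('X * t - (1 - 'X^2) * u, 'X * u + t)
  else (1, 0).

Lemma chebyshevS m : chebyshev m.+1 =
  ('X * (chebyshev m).1 - (1 - 'X^2) * (chebyshev m).2,
   'X * (chebyshev m).2 + (chebyshev m).1).
Proof. by rewrite /=; case: (chebyshev m). Qed.

Arguments chebyshev : simpl never.

(** One induction proves both identities, as the step for each uses the hypothesis on the other. *)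
Lemma deriv_chebyshev m :
  (chebyshev m).1^`() = m%:R * (chebyshev m).2 /\
  (1 - 'X^2) * (chebyshev m).2^`() =
    'X * (chebyshev m).2 - m%:R * (chebyshev m).1.
Proof.
elim: m => [|m [IH1 IH2]].
  by rewrite /chebyshev /= deriv0 -polyC1 derivC !mulr0 !mul0r subr0.
have dX : (1 - 'X^2 : {poly R})^`() = - ('X *+ 2).
  by rewrite derivB derivXn -polyC1 derivC sub0r expr1.
rewrite chebyshevS /= derivB derivD !derivM dX derivX IH1 -natr1.
split; first by rewrite IH2; ring.
set U := (chebyshev m).2 in IH2 *.
have -> : (1 - 'X^2) * (1 * U + 'X * U^`() + m%:R * U) =
    'X * ((1 - 'X^2) * U^`()) + (1 - 'X^2) * (1 * U + m%:R * U) by ring.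
by rewrite IH2; ring.
Qed.

Local Notation s x := (Num.sqrt (1 - x ^+ 2)).

Lemma half_pointE x : -1 <= x <= 1 -> half_point x = x +i* s x.
Proof. by move=> hx; rewrite /half_point clamp_id. Qed.

Lemma sqr_s x : -1 <= x <= 1 -> s x * s x = 1 - x ^+ 2.
Proof.
move=> /andP[h1 h2]; rewrite -expr2 sqr_sqrtr //.
by rewrite subr_ge0 -[1](expr1n R 2) -subr_ge0 subr_sqr mulr_ge0; lra.
Qed.

Lemma half_point_exp x m : -1 <= x <= 1 ->
  half_point x ^+ m = (chebyshev m).1.[x] +i* (s x * (chebyshev m).2.[x]).
Proof.
move=> hx; elim: m => [|m IH]; first by rewrite expr0 /chebyshev /= !hornerE.
rewrite exprS IH half_pointE // chebyshevS /=; simpc.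
move: (s x) (sqr_s hx) => r sE; have xE : x ^+ 2 = 1 - r * r by rewrite sE;
  ring.
by congr (_ +i* _); rewrite !hornerE /= ?xE; ring.
Qed.

(** Up to the factor [szego_scale n * half_point x ^+ n], this is the value at [lift_point x] of the
    [n]-th monic polynomial for the weight 1 ([szego_legendre]). *)
Definition legendre_pair n x : R[i] :=
  (n.+1%:R * (P n).[x]) +i* (s x * (P n)^`().[x]).

(** [legendreS] gives the real part and [deriv_legendreS] the imaginary part. The result differs
    from [legendre_pair n.+1 x] by the coefficient [n+1] in place of [n+2]. *)
Lemma half_point_pair n x : -1 <= x <= 1 ->
  half_point x * legendre_pair n x =
    (n.+1%:R * (P n.+1).[x]) +i* (s x * (P n.+1)^`().[x]).
Proof.
move=> hx; rewrite half_pointE // /legendre_pair; simpc.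
have e1 : n.+1%:R * (P n.+1).[x] =
    n.+1%:R * (x * (P n).[x]) + (x ^+ 2 - 1) * (P n)^`().[x].
  have := congr1 (horner ^~ x) (legendreS R n); rewrite -!polyC_natr.
  by rewrite /= !hornerE.
have e2 : (P n.+1)^`().[x] = x * (P n)^`().[x] + n.+1%:R * (P n).[x].
  by rewrite deriv_legendreS -polyC_natr !hornerE.
congr (_ +i* _).
  by rewrite e1 [s x * (s x * _)]mulrA sqr_s //; ring.
by rewrite e2; ring.
Qed.

(** The product of [2k/(2k+1)] over [1 <= k <= n]. *)
Fixpoint szego_scale n : R :=
  if n is k.+1 then szego_scale k * ((2 * k.+1)%:R / (2 * k + 3)%:R) else 1.

Lemma szego_scale_neq0 n : szego_scale n != 0.
Proof.
elim: n => [|n IH] /=; first by rewrite oner_eq0.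
by rewrite !mulf_neq0 // ?invr_eq0 pnatr_eq0 // addn3.
Qed.

(** By Legendre's equation and the derivative of [T_(n+1)], the integrand is the derivative of [q],
    which has the factor [x^2 - 1] and vanishes at both endpoints. *)
Lemma Rintegral_pair (a : R) n :
  \int[mu]_(x in `[-1, 1])
    complex.Re (half_point x ^+ n.+1 * (a%:C * legendre_pair n.+1 x)) = 0.
Proof.
pose q := (a / n.+1%:R) *: (('X^2 - 1) * (P n.+1)^`() * (chebyshev n.+1).1).
transitivity (\int[mu]_(x in `[-1, 1]) (q^`().[x])).
  apply: eq_Rintegral => x; rewrite inE /= in_itv /= => hx.
  rewrite mulrCA Re_scale half_point_exp // /legendre_pair; simpc => /=.
  have -> : q^`() = a *: (n.+2%:R * (P n.+1 * (chebyshev n.+1).1) +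
      ('X^2 - 1) * (P n.+1)^`() * (chebyshev n.+1).2).
    rewrite /q derivZ derivM legendre_ode (deriv_chebyshev n.+1).1.
    have -> : (n.+1 * n.+2)%:R * P n.+1 * (chebyshev n.+1).1 +
      ('X^2 - 1) * (P n.+1)^`() * (n.+1%:R * (chebyshev n.+1).2) =
      n.+1%:R * (n.+2%:R * (P n.+1 * (chebyshev n.+1).1) +
      ('X^2 - 1) * (P n.+1)^`() * (chebyshev n.+1).2).
      by rewrite natrM; ring.
    by rewrite -[n.+1%:R in X in _ *: X]polyC_natr mul_polyC scalerA divfK
      ?pnatr_eq0.
  rewrite -polyC_natr; move: (P n.+1) (s x) (sqr_s hx) => p0 r sE.
  have xE : x ^+ 2 = 1 - r * r by rewrite sE; ring.
  by rewrite !hornerE /= xE; ring.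
rewrite Rintegral_deriv /q !hornerE /=.
by rewrite sqrrN expr1n subrr !(mulr0, mul0r) subr0.
Qed.

Lemma herm11 x : herm (1 : {poly R}) 1 x = 1.
Proof. by rewrite /herm -[X in peval X]polyC1 pevalC conjc_real /= mulr0 subr0
  mulr1. Qed.

Let one : R -> R := cst 1.

Let c1 : {within `[-1, 1], continuous one}.
Proof. by apply: continuous_subspaceT => x; exact: cvg_cst. Qed.

Let one_gt0 x : x \in `[-1, 1] -> 0 < one x.
Proof. by move=> _; rewrite /one ltr01. Qed.

(** Write [u] for the half-angle point, [F] for the [n]-th pair and [k = 1/(2n+3)]. The left side is
    [u^(n+1) c_n (u F + k conj (u F))], so the real part of [u F] is scaled by [1 + k] and the
    imaginary part by [1 - k]. Now [(n+1)(1+k) = (n+2)(2n+2)/(2n+3)] and [1 - k = (2n+2)/(2n+3)]. *)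
Lemma peval_step (p : {poly R}) n x : -1 <= x <= 1 -> (size p <= n.+1)%N ->
  peval p x = half_point x ^+ n * ((szego_scale n)%:C * legendre_pair n x) ->
  peval ('X * p + (2 * n + 3)%:R^-1 *: rev_poly n p) x =
    half_point x ^+ n.+1 * ((szego_scale n.+1)%:C * legendre_pair n.+1 x).
Proof.
move=> hx sp pE; rewrite pevalD pevalM pevalX pevalZ peval_rev //
  pE /lift_point.
set u := half_point x; set v := conjc u.
have uv : u * v = 1 by exact: half_point_conj.
set k : R := (2 * n + 3)%:R^-1.
rewrite conjcM conjcX conjcM conjc_real -/v.
set F := legendre_pair n x.
have uvn : (u ^+ 2) ^+ n * v ^+ n = u ^+ n.+1 * v.
  have -> : u ^+ n.+1 * v = u ^+ n by rewrite exprSr -mulrA uv mulr1.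
  by rewrite -exprM mulnC mulnS muln1 // exprD -mulrA -exprMn uv expr1n mulr1.
have -> : u ^+ 2 * (u ^+ n * ((szego_scale n)%:C * F)) +
    k%:C * ((u ^+ 2) ^+ n * (v ^+ n * ((szego_scale n)%:C * conjc F))) =
    u ^+ n.+1 * ((szego_scale n)%:C * (u * F + k%:C * conjc (u * F))).
  rewrite conjcM -/v (mulrA _ (v ^+ n)) uvn (exprS u n); ring.
have -> : (szego_scale n.+1)%:C = (szego_scale n)%:C *
    ((2 * n.+1)%:R / (2 * n + 3)%:R)%:C by rewrite /= rmorphM.
rewrite half_point_pair // -mulrA; congr (_ * (_ * _)).
rewrite /legendre_pair; simpc.
have k3 : (2 * n + 3)%:R != 0 :> R by rewrite pnatr_eq0 addn3.
have e3 : (2 * n + 3)%:R = 2 * n%:R + 3 :> R by rewrite natrD natrM.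
rewrite /k natrM -[n.+2]addn2 -[n.+1]addn1 !(natrD _ n); rewrite e3 in k3 *.
by congr (_ +i* _); field.
Qed.

(** In [main], the closed form in degree [m] determines the reflection coefficient: with [-1/(2m+3)]
    the next polynomial is orthogonal to [1] by [Rintegral_pair]. Then [peval_step] advances the
    closed form. *)
Lemma szego_legendre n :
  (forall x, -1 <= x <= 1 -> peval (szego one n) x =
    half_point x ^+ n * ((szego_scale n)%:C * legendre_pair n x)) /\
  reflection one n = - (2 * n + 3)%:R^-1.
Proof.
have main m : (forall x, -1 <= x <= 1 -> peval (szego one m) x =
    half_point x ^+ m * ((szego_scale m)%:C * legendre_pair m x)) ->
    reflection one m = - (2 * m + 3)%:R^-1.
  move=> IH; have N0 : form one (szego one m) (szego one m) != 0.
    by rewrite gt_eqF // szego_norm_gt0.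
  have : form one ('X * szego one m + (2 * m + 3)%:R^-1 *: rev_poly m (szego
    one m)) 1 = 0.
    rewrite -[RHS](Rintegral_pair (szego_scale m.+1) m).
    apply: eq_Rintegral => x; rewrite inE /= in_itv /= => hx.
    rewrite /herm (@peval_step _ m x) ?size_szego // ?IH // mulr1.
    by rewrite -polyC1 pevalC conjc_real mulr1.
  rewrite formDl // formZl // form_rev_szego1 // => /eqP;
    rewrite addr_eq0 => /eqP E.
  by rewrite /reflection E -mulNr mulfK.
have base x : peval (szego one 0) x =
    half_point x ^+ 0 * ((szego_scale 0)%:C * legendre_pair 0 x).
  have d1 : (1 : {poly R})^`() = 0 by rewrite -polyC1 derivC.
  rewrite szego0 -[X in peval X]polyC1 pevalC expr0 /szego_scale !mul1r.
  by rewrite /legendre_pair legendre0 d1 !hornerE.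
elim: n => [|n [IH1 IH2]].
  by split; [move=> x _; exact: base|apply: (main 0%N) => x _; exact: base].
have E x : -1 <= x <= 1 -> peval (szego one n.+1) x =
    half_point x ^+ n.+1 * ((szego_scale n.+1)%:C * legendre_pair n.+1 x).
  move=> hx; rewrite szegoS IH2 scaleNr opprK.
  by apply: peval_step => //; [rewrite size_szego|exact: IH1].
by split => //; exact: main.
Qed.

(** Iterate [szego_normS], using [1 - 1/(2n+3)^2 = (2n+2)(2n+4)/(2n+3)^2]. *)
Lemma szego_legendre_norm n :
  form one (szego one n) (szego one n) = 2 * szego_scale n ^+ 2 * n.+1%:R.
Proof.
elim: n => [|n IH].
  transitivity (\int[mu]_(x in `[-1, 1]) (('X : {poly R})^`().[x])).
    apply: eq_Rintegral => x _.
    by rewrite szego0 herm11 mul1r derivX -polyC1 hornerC.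
  by rewrite Rintegral_deriv !hornerX /=; ring.
rewrite szego_normS // IH (szego_legendre n).2 /=.
have k3 : (2 * n + 3)%:R != 0 :> R by rewrite pnatr_eq0 addn3.
have e3 : (2 * n + 3)%:R = 2 * n%:R + 3 :> R by rewrite natrD natrM.
rewrite natrM -[n.+2]addn2 -[n.+1]addn1 !(natrD _ n); rewrite e3 in k3 *.
by field.
Qed.

Lemma legendre_sqrE n : (fun y => (P n).[y] ^+ 2) = horner (P n ^+ 2).
Proof. by apply/funext => y; rewrite horner_exp. Qed.

(** Write [(1 - x^2) (P_n^2)'] as [(1 - x^2) P_n'] times [2 P_n] and apply Legendre's equation. *)
Lemma legendre_op_sqr n x :
  legendre_op (fun y => (P n).[y] ^+ 2) x =
    2 * ((n * n.+1)%:R * (P n).[x] ^+ 2 - (1 - x ^+ 2) * (P n)^`().[x] ^+ 2).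
Proof.
rewrite legendre_sqrE legendre_op_horner.
have -> : - ((1 - 'X^2) * (P n ^+ 2)^`())^`() =
    (('X^2 - 1) * (P n)^`() * (P n *+ 2))^`().
  rewrite -derivN; congr deriv; rewrite expr2 derivM; ring.
rewrite derivM legendre_ode -polyC_natr derivMn.
by move: (P n) => p0; rewrite !hornerE /=; ring.
Qed.

Lemma form_szego_legendre (B : R -> R) n :
  {within `[-1, 1], continuous B} ->
  form B (szego one n.+1) (rev_poly n (szego one n)) =
    szego_scale n * szego_scale n.+1 / 2 *
    \int[mu]_(x in `[-1, 1])
      (B x * legendre_op (fun y => (P n.+1).[y] ^+ 2) x).
Proof.
move=> cB; rewrite -RintegralZl //; last first.
  apply: integrable_segment; apply: within_continuousM => //.
  rewrite (_ : legendre_op _ = horner (- ((1 - 'X^2) * (P n.+1 ^+ 2)^`())^`())).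
    by apply: continuous_subspaceT => x; exact: continuous_horner.
  by apply/funext => x; rewrite -legendre_op_horner legendre_sqrE.
apply: eq_Rintegral => x; rewrite inE /= in_itv /= => hx.
rewrite legendre_op_sqr /herm peval_rev ?size_szego // conjcM conjcX conjcK.
rewrite !(szego_legendre _).1 //.
set u := half_point x; set v := conjc u.
have uv : u * v = 1 by exact: half_point_conj.
have -> : conjc (lift_point x) = v ^+ 2 by exact: conjcX.
set F := legendre_pair n x; set F1 := legendre_pair n.+1 x.
(* Since [u v = 1], the powers collapse to a single [u], which [half_point_pair] absorbs into the
   [n]-th pair. *)
have E : u ^+ n.+1 * (v ^+ 2) ^+ n * u ^+ n = u.
  rewrite -exprM mul2n -addnn exprD exprS.
  have -> : u * u ^+ n * (v ^+ n * v ^+ n) * u ^+ n =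
    u * (u ^+ n * v ^+ n) * (u ^+ n * v ^+ n) by ring.
  by rewrite -exprMn uv expr1n !mulr1.
have -> : u ^+ n.+1 * ((szego_scale n.+1)%:C * F1) *
    ((v ^+ 2) ^+ n * (u ^+ n * ((szego_scale n)%:C * F))) =
    (szego_scale n.+1)%:C * ((szego_scale n)%:C * (F1 * (u * F))).
  by rewrite -[in RHS]E; ring.
rewrite !Re_scale half_point_pair // /F1 /legendre_pair; simpc.
rewrite [szego_scale n.+1]/=.
move: (P n.+1) (s x) (sqr_s hx) => p0 r sE; rewrite !natrM.
move: (_ / (2 * n + 3)%:R) => K.
have xE : x ^+ 2 = 1 - r * r by rewrite sE; ring.
by rewrite xE /=; field.
Qed.

End LegendreWeight.

(** * The circle lift as a measure *)

Section EtaMeasure.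
Variables (R : realType) (B : R -> R) (t : R).
Hypothesis cB : {within `[-1, 1], continuous B}.
Local Notation mu := (@lebesgue_measure R).
Local Notation D := (`[(-1 : R), 1]%classic).

Definition eta_mass : R := \int[mu]_(u in `[-1, 1]) tilt B t u.

Lemma eta_mass_gt0 : 0 < eta_mass.
Proof.
have -> : eta_mass = form (tilt B t) 1 1.
  by apply: eq_Rintegral => x _; rewrite herm11 mul1r.
apply: form_gt0; [exact: tilt_continuous|by move=> x _; exact: tilt_gt0|].
exact: oner_neq0.
Qed.

(** Extension by 0 makes [eta B t] the measure with density [g] on the whole line. *)
Let g : R -> R := eta_density B t \_ D.

Let gE x : eta_density B t x = tilt B t x / eta_mass.
Proof. by []. Qed.

Let g_ge0 x : 0 <= g x.
Proof.
rewrite /g patchE; case: ifP => // _;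
  rewrite gE divr_ge0 ?(ltW eta_mass_gt0) //.
exact/ltW/tilt_gt0.
Qed.

Let integrable_density : mu.-integrable D (EFin \o eta_density B t).
Proof.
apply: integrable_segment;
  rewrite (_ : eta_density B t = fun x => tilt B t x * eta_mass^-1) //.
apply: within_continuousM; first exact: tilt_continuous.
by move=> x; exact: cvg_cst.
Qed.

Let integrable_g : mu.-integrable setT (EFin \o g).
Proof.
rewrite /g -restrict_EFin; apply/integrable_restrict => //=.
by rewrite setTI.
Qed.

Lemma eta_induced : eta B t = (fun A => \int[mu]_(x in A) (g x)%:E)%E.
Proof.
apply/funext => A; rewrite /eta integral_mkcondr.
by apply: eq_integral => x _; rewrite /g !patchE; case: ifP.
Qed.

Let eta0 : eta B t set0 = 0%E.
Proof. by rewrite eta_induced integral_set0. Qed.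

Let eta_ge0 A : (0 <= eta B t A)%E.
Proof. by rewrite eta_induced; apply: integral_ge0 => x _; rewrite lee_fin. Qed.

Let eta_sigma_additive : semi_sigma_additive (eta B t).
Proof.
rewrite eta_induced; apply: semi_sigma_additive_nng_induced.
  exact: measurable_int integrable_g.
by move=> x; rewrite lee_fin.
Qed.

HB.instance Definition _ := isMeasure.Build _ _ _ (eta B t)
  eta0 eta_ge0 eta_sigma_additive.

Let eta_finite : fin_num_fun (eta B t).
Proof.
move=> A mA; rewrite eta_induced; apply: integrable_fin_num => //.
exact: integrableS integrable_g.
Qed.

HB.instance Definition _ := @Measure_isFinite.Build _ _ _ (eta B t) eta_finite.

Let eta_dom : eta B t `<< mu.
Proof.
apply/null_content_dominatesP => A mA muA0; rewrite eta_induced.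
apply: null_set_integral => //.
exact: measurable_funS (measurable_int _ integrable_g).
Qed.

Definition eta_measure : {finite_measure set (measurableTypeR R) -> \bar R} :=
  eta B t.

Lemma integrable_eta (h : R -> R) : measurable_fun setT h ->
  (exists M : R, forall x, `|h x| <= M) ->
  eta_measure.-integrable setT (EFin \o h).
Proof.
move=> mh [M hM]; apply: measurable_bounded_integrable => //.
  by rewrite ltey_eq fin_num_measure.
exists M; split; first exact: num_real.
by move=> N MN x _; rewrite /= (le_trans (hM x)) // ltW.
Qed.

(** The Radon-Nikodym derivative of [eta B t] equals [g] almost everywhere, because both have the
    same integral over every measurable set. *)
Lemma integral_eta (h : R -> R) : measurable_fun setT h ->
  (exists M : R, forall x, `|h x| <= M) ->
  (\int[eta_measure]_x (h x)%:E =
   (eta_mass^-1 * \int[mu]_(x in `[-1, 1]) (h x * tilt B t x))%:E)%E.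
Proof.
move=> mh [M hM].
have ih := integrable_eta mh (ex_intro _ M hM).
rewrite -(Radon_Nikodym_change_of_variables eta_dom) //=.
transitivity (\int[mu]_x ((h x)%:E * (g x)%:E))%E.
  apply: ae_eq_integral => //.
  - apply: emeasurable_funM; first exact/measurable_EFinP.
    apply: (measurable_int mu).
    by apply: Radon_Nikodym_integrable; exact: eta_dom.
  - apply: emeasurable_funM; first exact/measurable_EFinP.
    exact: measurable_int integrable_g.
  - apply: ae_eqe_mul2l => /=.
    rewrite (Radon_NikodymE (nu := charge_of_finite_measure eta_measure)
      eta_dom).
    case: cid => /= f [f_fin f_int fE].
    apply: integral_ae_eq => //=; first exact: measurable_int integrable_g.
    move=> E _ mE; rewrite -fE //.
    by rewrite -[LHS]/(eta B t E) eta_induced.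
have it : mu.-integrable D (EFin \o tilt B t).
  exact/integrable_segment/tilt_continuous.
have ic : mu.-integrable D (EFin \o (fun x => h x * tilt B t x)).
  apply: (@le_integrable _ _ _ mu _ _ _ (EFin \o (fun x => M * tilt B t x))) =>
    //.
  - apply/measurable_EFinP; apply: measurable_funM;
      first exact: measurable_funTS.
    by apply/measurable_EFinP; exact: measurable_int it.
  - move=> x _; rewrite /= lee_fin !normrM ler_wpM2r //.
    by rewrite (le_trans (hM x)) // ler_norm.
  - apply: integrable_segment; apply: within_continuousM; first by move=> x;
      exact: cvg_cst.
    exact: tilt_continuous.
transitivity (\int[mu]_(x in `[(-1)%R, 1%R]) (eta_mass^-1%:E * (h x * tilt B t
  x)%:E))%E.
  rewrite [RHS]integral_mkcond; apply: eq_integral => x _.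
  rewrite /g !patchE; case: ifP => _; last by rewrite mule0.
  by rewrite -!EFinM gE; congr (_%:E); ring.
rewrite integralZl // EFinM; congr (_ * _)%E.
by rewrite /Rintegral fineK // integrable_fin_num.
Qed.

End EtaMeasure.

(** * Measurability of complex-valued functions *)

Section ComplexMeasurable.
Variable R : realType.
Local Open Scope complex_scope.

Definition complex_measurable d (T : measurableType d) (f : T -> R[i]) : Prop :=
  measurable_fun setT (fun p => complex.Re (f p)) /\
  measurable_fun setT (fun p => complex.Im (f p)).

Lemma complex_measurable_cst d (T : measurableType d) (c : R[i]) :
  complex_measurable (fun _ : T => c).
Proof. by split; exact: measurable_cst. Qed.

Lemma complex_measurableD d (T : measurableType d) (f g : T -> R[i]) :
  complex_measurable f -> complex_measurable g ->
  complex_measurable (fun p => f p + g p).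
Proof.
move=> [fr fi] [gr gi]; split.
- have -> : (fun p => complex.Re (f p + g p)) =
      (fun p => complex.Re (f p) + complex.Re (g p)).
    by apply/funext => p; case: (f p) (g p) => [? ?] [].
  exact: measurable_funD.
- have -> : (fun p => complex.Im (f p + g p)) =
      (fun p => complex.Im (f p) + complex.Im (g p)).
    by apply/funext => p; case: (f p) (g p) => [? ?] [].
  exact: measurable_funD.
Qed.

Lemma complex_measurableM d (T : measurableType d) (f g : T -> R[i]) :
  complex_measurable f -> complex_measurable g ->
  complex_measurable (fun p => f p * g p).
Proof.
move=> [fr fi] [gr gi]; split.
- have -> : (fun p => complex.Re (f p * g p)) = (fun p =>
      complex.Re (f p) * complex.Re (g p) - complex.Im (f p) * complex.Im (g
        p)).
    by apply/funext => p; case: (f p) (g p) => [? ?] [].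
  by apply: measurable_funB; exact: measurable_funM.
- have -> : (fun p => complex.Im (f p * g p)) = (fun p =>
      complex.Re (f p) * complex.Im (g p) + complex.Im (f p) * complex.Re (g
        p)).
    by apply/funext => p; case: (f p) (g p) => [? ?] [].
  by apply: measurable_funD; exact: measurable_funM.
Qed.

Lemma complex_measurable_conj d (T : measurableType d) (f : T -> R[i]) :
  complex_measurable f -> complex_measurable (fun p => conjc (f p)).
Proof.
move=> [fr fi]; split.
- have -> : (fun p => complex.Re (conjc (f p))) = (fun p => complex.Re (f p)).
    by apply/funext => p; case: (f p).
  by [].
- have -> : (fun p => complex.Im (conjc (f p))) = (fun p => - complex.Im (f p)).
    by apply/funext => p; case: (f p).
  exact: measurableT_comp.
Qed.

Lemma complex_measurable_horner d (T : measurableType d) (P : {poly R[i]})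
    (f : T -> R[i]) : complex_measurable f -> complex_measurable (fun p =>
      P.[f p]).
Proof.
move=> mf; elim/poly_ind: P => [|P c IH].
  by under eq_fun do rewrite horner0; exact: complex_measurable_cst.
under eq_fun do rewrite hornerMXaddC.
apply: complex_measurableD; last exact: complex_measurable_cst.
exact: complex_measurableM.
Qed.

Lemma complex_measurable_to_complex :
  complex_measurable (fun p : measurableTypeR R * measurableTypeR R =>
    to_complex p).
Proof. by split; [exact: measurable_fst|exact: measurable_snd]. Qed.

End ComplexMeasurable.

(** * Integration against the circle lift and its Verblunsky coefficients *)

Section CircleLift.
Variable R : realType.
Local Notation mu := (@lebesgue_measure R).
Local Open Scope complex_scope.
Implicit Types (p q : {poly R}) (x : R).

Lemma Rintegral_odd (f : R -> R) : {within `[-1, 1], continuous f} ->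
  (forall x, x \in `[-1, 1] -> f (- x) = - f x) ->
  \int[mu]_(x in `[-1, 1]) f x = 0.
Proof.
move=> cf fodd.
have := @integration_by_substitution_oppr _ f (-1) 1; rewrite opprK.
have le11 : -1 <= 1 :> R by lra.
move=> /(_ le11 cf) E.
have : \int[mu]_(x in `[-1, 1]) f x = \int[mu]_(x in `[-1, 1]) (-1 * f x).
  rewrite /Rintegral E; congr fine; apply: eq_integral => x;
    rewrite inE /= => hx.
  by rewrite fodd // mulN1r.
rewrite RintegralZl //; last exact: integrable_segment.
by lra.
Qed.

Definition hermi p q x : R := complex.Im (peval p x * conjc (peval q x)).

Lemma hermi_continuous p q : continuous (hermi p q).
Proof.
have [pr pi] := peval_continuous p; have [qr qi] := peval_continuous q.
have -> : hermi p q = (fun x =>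
    complex.Im (peval p x) * complex.Re (peval q x) -
    complex.Re (peval p x) * complex.Im (peval q x)).
  apply/funext => y; rewrite /hermi.
  by case: (peval p y) (peval q y) => [a b] [a' b']; simpc; rewrite /=; ring.
move=> x; apply: cvgB; apply: cvgM;
  [exact: pi|exact: qr|exact: pr|exact: qi].
Qed.

Lemma hermiN p q x : hermi p q (- x) = - hermi p q x.
Proof.
rewrite /hermi !peval_opp -conjcM.
by case: (_ * _).
Qed.

Lemma lift_point_clamp x : lift_point (clamp x) = lift_point x.
Proof. by rewrite /lift_point /half_point (clamp_id (clamp_bounds x)). Qed.

(** All values are already taken on the compact interval [[-1, 1]]. *)
Lemma bounded_clamp (k : R -> R) : continuous k ->
  (forall x, k (clamp x) = k x) -> exists M : R, forall x, `|k x| <= M.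
Proof.
move=> ck kc.
have /compact_bounded[M [_ hM]] : compact (k @` `[-1, 1]).
  apply: continuous_compact; last exact: segment_compact.
  exact: continuous_subspaceT.
exists (M + 1) => x; rewrite -kc; apply: hM; first by rewrite ltrDl.
exists (clamp x) => //=; rewrite in_itv /=; exact: clamp_bounds.
Qed.

Section Eta.
Variables (B : R -> R) (t : R).
Hypothesis cB : {within `[-1, 1], continuous B}.
Hypothesis B_even : forall x, x \in `[-1, 1] -> B (- x) = B x.

(** A continuous map on the whole line that agrees with [circle_point] on [[-1, 1]], where [eta B t]
    is carried. *)
Let cp (x : measurableTypeR R) : measurableTypeR R * measurableTypeR R :=
  (complex.Re (lift_point x), complex.Im (lift_point x)).

Let measurable_cp : measurable_fun setT cp.
Proof.
have [cr ci] := lift_point_continuous R.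
by apply: measurable_fun_pair; apply: continuous_measurable_fun.
Qed.

Lemma circle_pointE x : -1 <= x <= 1 -> circle_point x = cp x.
Proof.
move=> hx; have hx2 : x \in `[-1, 1] by rewrite in_itv.
rewrite /circle_point /cp /lift_point half_pointE //
  !mulr_natl cos_mulr2n sin_mulr2n.
rewrite acosK // sin_acos //; simpc => /=; rewrite sqr_s //.
by congr (_, _); ring.
Qed.

Lemma circle_liftE : circle_lift (eta B t) = pushforward (eta B t) cp.
Proof.
apply/funext => A; rewrite /circle_lift /pushforward /eta.
congr integral; apply/seteqP; split => x /= [Ax hx]; split => //.
  by rewrite /preimage /= -circle_pointE.
by rewrite /preimage /= circle_pointE.
Qed.

Lemma integral_circle_lift (g : R * R -> R) :
  measurable_fun setT (g : measurableTypeR R * measurableTypeR R -> R) ->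
  continuous (g \o cp) ->
  (\int[circle_lift (eta B t)]_p (g p)%:E =
   ((eta_mass B t)^-1 * \int[mu]_(x in `[-1, 1]) (g (cp x) * tilt B t x))%:E)%E.
Proof.
move=> mg cg; rewrite circle_liftE.
have hb : exists M : R, forall x, `|(g \o cp) x| <= M.
  by apply: bounded_clamp => // x; rewrite /= /cp lift_point_clamp.
have mh : measurable_fun setT (g \o cp) by exact: measurableT_comp.
rewrite -(integral_eta t cB mh hb).
rewrite -[RHS](@integral_pushforward _ _ _ _ _ cp measurable_cp (eta_measure t
  cB)
  setT (EFin \o g)) //.
- exact/measurable_EFinP.
- exact: integrable_eta.
Qed.

Lemma complex_integral_lift (F : R[i] -> R[i]) :
  complex_measurable
    (fun y : measurableTypeR R * measurableTypeR R => F (to_complex y)) ->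
  continuous (fun x => complex.Re (F (lift_point x))) ->
  continuous (fun x => complex.Im (F (lift_point x))) ->
  complex_integral (circle_lift (eta B t)) F =
    ((eta_mass B t)^-1 *
       \int[mu]_(x in `[-1, 1]) (complex.Re (F (lift_point x)) * tilt B t x))
         +i*
    ((eta_mass B t)^-1 *
       \int[mu]_(x in `[-1, 1]) (complex.Im (F (lift_point x)) * tilt B t x)).
Proof.
have toE x : to_complex (cp x) = lift_point x by rewrite /cp /to_complex;
  case: (lift_point x).
move=> [mr mi] cr ci; rewrite /complex_integral.
have cr' : continuous ((fun y => complex.Re (F (to_complex y))) \o cp).
  by rewrite (_ : _ \o _ = fun x => complex.Re (F (lift_point x))) //;
    apply/funext => x /=; rewrite toE.
have ci' : continuous ((fun y => complex.Im (F (to_complex y))) \o cp).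
  by rewrite (_ : _ \o _ = fun x => complex.Im (F (lift_point x))) //;
    apply/funext => x /=; rewrite toE.
rewrite (integral_circle_lift mr cr') (integral_circle_lift mi ci').
by congr (_ +i* _); rewrite /=; congr (_ * _); apply: eq_Rintegral => x _;
  rewrite toE.
Qed.

Lemma tilt_even x : x \in `[-1, 1] -> tilt B t (- x) = tilt B t x.
Proof. by move=> hx; rewrite /tilt B_even. Qed.

Lemma Rintegral_hermi p q :
  \int[mu]_(x in `[-1, 1]) (hermi p q x * tilt B t x) = 0.
Proof.
apply: Rintegral_odd.
  apply: within_continuousM; last exact: tilt_continuous.
  exact/continuous_subspaceT/hermi_continuous.
by move=> x hx; rewrite hermiN tilt_even // mulNr.
Qed.

(** Candidates in [monic_orthogonal] have complex coefficients; they are split into two real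
    polynomials. *)
Definition Re_poly (P : {poly R[i]}) : {poly R} := map_poly (@complex.Re R) P.
Definition Im_poly (P : {poly R[i]}) : {poly R} := map_poly (@complex.Im R) P.

Lemma horner_lift_point (P : {poly R[i]}) x :
  P.[lift_point x] = peval (Re_poly P) x + 'i%C * peval (Im_poly P) x.
Proof.
rewrite /peval -hornerZ -hornerD; congr (_.[_]).
apply/polyP => k; rewrite coefD coefZ !coef_map /=.
by case: (P`_k) => a b; simpc.
Qed.

(** The [hermi] terms integrate to 0, so complex orthogonality decouples into one real condition on
    each part. *)
Lemma complex_integral_orth (P : {poly R[i]}) k :
  complex_integral (circle_lift (eta B t)) (fun z => P.[z] * (z ^+ k)^*%R) =
    ((eta_mass B t)^-1 * form (tilt B t) (Re_poly P) 'X^k) +i*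
    ((eta_mass B t)^-1 * form (tilt B t) (Im_poly P) 'X^k).
Proof.
set p := Re_poly P; set q := Im_poly P.
have FE x : P.[lift_point x] * conjc (lift_point x ^+ k) =
    (herm p 'X^k x - hermi q 'X^k x) +i* (hermi p 'X^k x + herm q 'X^k x).
  rewrite horner_lift_point -pevalXn /herm /hermi -/p -/q.
  by case: (peval p x) (peval q x) (peval 'X^k x) => [a b] [c d] [e f]; simpc;
    congr (_ +i* _); rewrite /=; ring.
have -> : (fun z => P.[z] * (z ^+ k)^*%R) = (fun z =>
  P.[z] * conjc (z ^+ k)) by [].
rewrite complex_integral_lift.
- congr (_ +i* _); congr (_ * _).
    transitivity (\int[mu]_(x in `[-1, 1])
      (herm p 'X^k x * tilt B t x - hermi q 'X^k x * tilt B t x)).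
      by apply: eq_Rintegral => x _; rewrite FE mulrBl.
    rewrite RintegralB ?Rintegral_hermi ?subr0 //; apply: integrable_segment.
      exact/within_herm/tilt_continuous.
    apply: within_continuousM; last exact: tilt_continuous.
    exact/continuous_subspaceT/hermi_continuous.
  transitivity (\int[mu]_(x in `[-1, 1])
    (hermi p 'X^k x * tilt B t x + herm q 'X^k x * tilt B t x)).
    by apply: eq_Rintegral => x _; rewrite FE mulrDl.
  rewrite RintegralD ?Rintegral_hermi ?add0r //; apply: integrable_segment.
    apply: within_continuousM; last exact: tilt_continuous.
    exact/continuous_subspaceT/hermi_continuous.
  exact/within_herm/tilt_continuous.
- apply: complex_measurableM.
    exact/complex_measurable_horner/complex_measurable_to_complex.
  apply: complex_measurable_conj.
  under eq_fun do rewrite -hornerXn.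
  exact/complex_measurable_horner/complex_measurable_to_complex.
- under eq_fun do rewrite FE /=.
  by move=> x; apply: cvgB; [exact: herm_continuous|exact: hermi_continuous].
- under eq_fun do rewrite FE /=.
  by move=> x; apply: cvgD; [exact: hermi_continuous|exact: herm_continuous].
Qed.

Local Notation w := (tilt B t).

Let cw : {within `[-1, 1], continuous w}.
Proof. exact: tilt_continuous. Qed.

Let w0 x : x \in `[-1, 1] -> 0 < w x.
Proof. by move=> _; exact: tilt_gt0. Qed.

Lemma Re_poly_map p : Re_poly (map_poly (real_complex R) p) = p.
Proof. by apply/polyP => k; rewrite coef_map_id0 // coef_map. Qed.

Lemma Im_poly_map p : Im_poly (map_poly (real_complex R) p) = 0.
Proof. by apply/polyP => k; rewrite coef_map_id0 // coef_map coef0. Qed.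

(** For uniqueness: the leading coefficient 1 is real, so the imaginary part has degree below [j]
    and is 0 by orthogonality; the real part is then monic and orthogonal. *)
Lemma monic_orthogonal_szego j :
  monic_orthogonal (circle_lift (eta B t)) j =
    map_poly (real_complex R) (szego w j).
Proof.
have m0 : (eta_mass B t)^-1 != 0 by rewrite invr_eq0 gt_eqF // eta_mass_gt0.
apply: xget_unique => [|P [Pm sP Po]].
  split.
  - by rewrite map_monic szego_monic.
  - by rewrite size_map_poly size_szego.
  - move=> k kj; rewrite complex_integral_orth Re_poly_map Im_poly_map.
    by rewrite form0l // szego_orth // !mulr0.
have ro k : (k < j)%N -> form w (Re_poly P) 'X^k = 0 /\
  form w (Im_poly P) 'X^k = 0.
  move=> kj; have := Po k kj; rewrite complex_integral_orth => /eqP.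
  rewrite eq_complex /= !mulf_eq0 (negbTE m0) /= => /andP[/eqP -> /eqP ->].
  by [].
have lP : P`_j = 1 by move: Pm; rewrite monicE lead_coefE sP => /eqP.
have qz : Im_poly P = 0.
  apply: (@orth_size_eq0 _ w cw w0 _ j) => [|k kj]; last by have [] := ro k kj.
  apply/leq_sizeP => i; rewrite leq_eqVlt => /predU1P[<-|ji].
    by rewrite coef_map_id0 // lP.
  by rewrite coef_map_id0 // nth_default // sP.
have pc i : (Re_poly P)`_i = complex.Re P`_i by rewrite coef_map_id0.
have sp : size (Re_poly P) = j.+1.
  apply/eqP; rewrite eqn_leq; apply/andP; split.
    by apply/leq_sizeP => i ji; rewrite pc nth_default // sP.
  rewrite ltnNge; apply/negP => /leq_sizeP /(_ j (leqnn j)).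
  by rewrite pc lP /= => /eqP; rewrite oner_eq0.
have pm : Re_poly P \is monic by rewrite monicE lead_coefE sp /= pc lP.
have <- : Re_poly P = szego w j.
  by apply: (szego_unique cw w0 pm sp) => k kj; have [] := ro k kj.
apply/polyP => i; rewrite coef_map /= pc.
have : (Im_poly P)`_i = 0 by rewrite qz coef0.
by rewrite coef_map_id0 //; case: (P`_i) => a b /= ->.
Qed.

(** The positive integers provide more distinct roots than the degree allows. *)
Lemma poly_eq0_nonzero (p : {poly R[i]}) :
  (forall z, z != 0 -> p.[z] = 0) -> p = 0.
Proof.
move=> pz; apply/eqP; apply: contraT => p0.
have := @max_poly_roots _ p [seq (k.+1%:R : R[i]) | k <- iota 0 (size p)] p0.
rewrite size_map size_iota ltnn => H; suff: false by []; apply: H.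
  apply/allP => _ /mapP[k _ ->]; apply/rootP/pz.
  by rewrite pnatr_eq0.
rewrite map_inj_uniq ?iota_uniq // => k l /eqP.
by rewrite eqr_nat => /eqP [].
Qed.

(** The recursion shows that the coefficient qualifies. It is the only one, since the reversed
    polynomial has the same positive norm as [szego w j] and hence is not 0. *)
Lemma verblunsky_reflection j :
  verblunsky (circle_lift (eta B t)) j = reflection w j.
Proof.
have revE z : z != 0 ->
    reversed j (map_poly (real_complex R) (szego w j)) z =
    (map_poly (real_complex R) (rev_poly j (szego w j))).[z].
  move=> z0; rewrite map_rev_poly horner_rev_poly ?size_map_poly ?size_szego //.
  rewrite /reversed; congr (_ * _).
  rewrite -[LHS]/(conjc (map_poly (real_complex R) (szego w j)).[(conjc z)^-1]).
  by rewrite horner_map_conj conjc_inv conjcK.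
have E z : (map_poly (real_complex R) (szego w j.+1)).[z] =
    z * (map_poly (real_complex R) (szego w j)).[z] -
    (reflection w j)%:C * (map_poly (real_complex R) (rev_poly j (szego w
      j))).[z].
  rewrite szegoS rmorphB rmorphM /= map_polyX map_polyZ.
  by rewrite !hornerE.
apply: xget_unique => [z z0|a ha].
  by rewrite !monic_orthogonal_szego revE // E.
apply/eqP; rewrite -subr_eq0; apply/eqP.
have : (a - reflection w j)%:C *: map_poly (real_complex R) (rev_poly j (szego
  w j)) = 0.
  apply: poly_eq0_nonzero => z z0; rewrite hornerZ.
  have := ha z z0; rewrite !monic_orthogonal_szego revE // E.
  move=> /addrI /oppr_inj H.
  by rewrite rmorphB mulrBl /= H subrr.
move/eqP; rewrite scaler_eq0 => /orP[/eqP/complexI //|].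
rewrite map_poly_eq0 => /eqP rz.
have := szego_norm_gt0 cw w0 j.
by rewrite -(form_rev _ (j := j)) ?size_szego // rz form0l // ltxx.
Qed.

End Eta.
End CircleLift.

(** * Green's identity *)

Section Green.
Variables (R : realType) (B : R -> R) (q : {poly R}).
Local Notation mu := (@lebesgue_measure R).
Hypothesis cB : {within `[-1, 1], continuous B}.
Hypothesis B_C2 : C2_on_interior B.
Hypothesis iLB : mu.-integrable `]-1, 1[ (EFin \o legendre_op B).
Hypothesis limN1 : (1 - x ^+ 2) * derive1 B x @[x --> (-1)^'+] --> (0 : R).
Hypothesis lim1 : (1 - x ^+ 2) * derive1 B x @[x --> 1^'-] --> (0 : R).

Let B1 := derive1 B.
Let B2 := derive1 B1.

Let dB (x : R) : x \in `]-1, 1[ -> is_derive x (1 : R) B (B1 x).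
Proof. by move=> /B_C2[h _ _]; exact: (DeriveDef h (esym (derive1E B x))). Qed.

Let dB1 (x : R) : x \in `]-1, 1[ -> is_derive x (1 : R) B1 (B2 x).
Proof. by move=> /B_C2[_ h _]; exact: (DeriveDef h (esym (derive1E B1 x))). Qed.

Let legendre_opE (x : R) : x \in `]-1, 1[ ->
  legendre_op B x = 2 * x * B1 x - (1 - x ^+ 2) * B2 x.
Proof.
move=> hx; have db := dB1 hx.
rewrite /legendre_op derive1E.
have H : is_derive x (1 : R) (fun y => (1 - y ^+ 2) * B1 y)
    (- (2 * x * B1 x - (1 - x ^+ 2) * B2 x)).
  apply: is_derive_eq.
  by rewrite /GRing.scale /=; ring.
by rewrite (@derive_val _ _ _ _ _ _ _ H) opprK.
Qed.

Let L : {poly R} := - ((1 - 'X^2) * q^`())^`().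

(** The boundary term of Green's identity, with derivative [e]. *)
Let G (x : R) : R := (1 - x ^+ 2) * B1 x * q.[x] - (1 - x ^+ 2) * q^`().[x] * B
  x.

(** The Green integrand with the operator on [B] expanded, so that its continuity follows from
    [B_C2]. *)
Let e (x : R) : R := B x * L.[x] - q.[x] * (2 * x * B1 x - (1 - x ^+ 2) * B2 x).

Let dG (x : R) : x \in `]-1, 1[ -> is_derive x (1 : R) G (e x).
Proof.
move=> hx; have db := dB hx; have db1 := dB1 hx.
have dq := is_derive_poly q x; have dq1 := is_derive_poly q^`() x.
rewrite /G; apply: is_derive_eq.
have LE : L = 'X *+ 2 * q^`() - (1 - 'X^2) * q^`()^`().
  by rewrite /L derivM derivB derivXn -polyC1 derivC sub0r expr1; ring.
by rewrite /e LE !hornerE /GRing.scale /=; ring.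
Qed.

Let e_continuous (x : R) : x \in `]-1, 1[ -> {for x, continuous e}.
Proof.
move=> hx; have [h0 h1 c2] := B_C2 hx.
have c0 := differentiable_continuous (iffLR (derivable1_diffP _ _) h0).
have c1 := differentiable_continuous (iffLR (derivable1_diffP _ _) h1).
rewrite /e; apply: cvgB; first by apply: cvgM => //; exact: continuous_horner.
apply: cvgM; first exact: continuous_horner.
apply: cvgB.
  by apply: cvgM => //; apply: cvgM; [exact: cvg_cst|exact: cvg_id].
apply: cvgM => //; apply: cvgB; first exact: cvg_cst.
by apply: cvgM; exact: cvg_id.
Qed.

Let f0 (x : R) : R := B x * L.[x] - q.[x] * legendre_op B x.

Let iBL : mu.-integrable `]-1, 1[ (EFin \o (fun x => B x * L.[x])).
Proof.
apply: (@integrableS _ _ _ mu `[-1, 1]) => //; first exact: subset_itv_oo_cc.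
apply: integrable_segment; apply: within_continuousM => //.
by apply: continuous_subspaceT => x; exact: continuous_horner.
Qed.

Let iqL : mu.-integrable `]-1, 1[ (EFin \o (fun x => q.[x] * legendre_op B x)).
Proof.
have [M hM] : exists M : R, forall x : R, x \in `[-1, 1] -> `|q.[x]| <= M.
  have /compact_bounded[M [_ hM]] : compact (horner q @` `[-1, 1]).
    apply: continuous_compact; last exact: segment_compact.
    by apply: continuous_subspaceT => x; exact: continuous_horner.
  by exists (M + 1) => x hx; apply: hM; [rewrite ltrDl|exists x].
apply: (@le_integrable _ _ _ mu _ _ _ (EFin \o (fun x =>
  M * legendre_op B x))) => //.
- apply/measurable_EFinP; apply: measurable_funM.
    by apply: measurable_funTS; apply: continuous_measurable_fun;
      exact: continuous_horner.
  by apply/measurable_EFinP; exact: measurable_int iLB.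
- move=> x hx; rewrite /= lee_fin !normrM ler_wpM2r //.
  by rewrite (le_trans _ (ler_norm _)) // hM //; exact: subset_itv_oo_cc hx.
- exact: (integrableZl _ M iLB).
Qed.

(** Set to 0 at the endpoints, since the hypotheses control [legendre_op B] only on the open
    interval. *)
Let f : R -> R := f0 \_ `]-1, 1[.

Let if0 : mu.-integrable `]-1, 1[ (EFin \o f0).
Proof.
exact: (integrableB _ iBL iqL).
Qed.

Let if_ : mu.-integrable `[-1, 1] (EFin \o f).
Proof.
rewrite /f -restrict_EFin; apply/integrable_restrict => //=.
by rewrite setIidr //; exact: subset_itv_oo_cc.
Qed.

Let F (x : R) : R := \int[mu]_(y in `[-1, x]) f y.

(** On [[a, b]], away from the endpoints, [e] is continuous and the fundamental theorem of calculus
    applies to [G]. *)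
Let F_increment (a b : R) : -1 < a -> a < b -> b < 1 -> F b - F a = G b - G a.
Proof.
move=> a1 ab b1.
have sub : `[a, b] `<=` `]-1, 1[.
  by move=> x; rewrite /= !in_itv /= => /andP[h1 h2]; apply/andP; split; lra.
rewrite /F (@Rintegral_itvB _ f (BLeft (-1)) (BRight b) a); last 3 first.
- by apply: integrableS if_ => //; apply: subset_itvl; rewrite bnd_simp ltW.
- by rewrite bnd_simp ltW.
- by rewrite bnd_simp ltW.
rewrite Rintegral_itv_obnd_cbnd; last first.
  apply: integrableS if_ => //; move=> x; rewrite /= !in_itv /= => /andP[h1 h2].
  by apply/andP; split; lra.
transitivity (\int[mu]_(x in `[a, b]) e x).
  apply: eq_Rintegral => x; rewrite inE => /sub hx.
  by rewrite /f patchE mem_set // /f0 legendre_opE.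
rewrite /Rintegral (@continuous_FTC2 _ e G) //.
- apply: continuous_in_subspaceT => x; rewrite inE => /sub; exact: e_continuous.
- have cG x : x \in `[a, b] -> {for x, continuous G}.
    move=> /sub /dG [h _].
    exact: (differentiable_continuous (iffLR (derivable1_diffP _ _) h)).
  split.
  + by move=> x /subset_itv_oo_cc /sub /dG [].
  + by apply: cvg_at_right_filter; apply: cG; rewrite in_itv /= lexx ltW.
  + by apply: cvg_at_left_filter; apply: cG; rewrite in_itv /= lexx ltW.
- move=> x /subset_itv_oo_cc /sub /dG h.
  by rewrite derive1E; exact: derive_val.
Qed.

Let cB_ends : B @ (-1)^'+ --> B (-1) /\ B @ 1^'- --> B 1.
Proof.
have lt11 : -1 < 1 :> R by lra.
by have /(continuous_within_itvP _ lt11) [] := cB.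
Qed.

Let GN1 : G @ (-1)^'+ --> (0 : R).
Proof.
have -> : 0 = 0 * q.[-1] - (1 - (-1) ^+ 2) * q^`().[-1] * B (-1) :> R.
  by ring.
rewrite /G; apply: cvgB; apply: cvgM.
- exact: limN1.
- by apply: cvg_at_right_filter; exact: continuous_horner.
- apply: cvg_at_right_filter; apply: cvgM; last exact: continuous_horner.
  by apply: cvgB; [exact: cvg_cst|apply: cvgM; exact: cvg_id].
- exact: (cB_ends.1).
Qed.

Let G1 : G @ 1^'- --> (0 : R).
Proof.
have -> : 0 = 0 * q.[1] - (1 - 1 ^+ 2) * q^`().[1] * B 1 :> R.
  by ring.
rewrite /G; apply: cvgB; apply: cvgM.
- exact: lim1.
- by apply: cvg_at_left_filter; exact: continuous_horner.
- apply: cvg_at_left_filter; apply: cvgM; last exact: continuous_horner.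
  by apply: cvgB; [exact: cvg_cst|apply: cvgM; exact: cvg_id].
- exact: (cB_ends.2).
Qed.

(** [F - G] is constant on the open interval. As [G] tends to 0 at both ends and [F] is continuous
    on [[-1, 1]], the values [F 1] and [F (-1)] agree, and the latter is an integral over a
    point. *)
Let F_end : F 1 = 0.
Proof.
have lt11 : -1 < 1 :> R by lra.
have [_ FN1 F1] : [/\ {in `]-1, 1[, continuous F}, F @ (-1)^'+ --> F (-1)
    & F @ 1^'- --> F 1].
  apply/(continuous_within_itvP _ lt11).
  by apply: parameterized_integral_continuous => //; exact: ltW.
have c1 : F x - G x @[x --> 1^'-] --> F 0 - G 0.
  have : (fun _ : R => F 0 - G 0) x @[x --> 1^'-] --> F 0 - G 0 by exact:
    cvg_cst.
  apply: cvg_trans; apply: near_eq_cvg.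
  near=> x; have x0 : 0 < x by near: x; exact: nbhs_left_gt.
  have x1 : x < 1 by near: x; exact: nbhs_left_lt.
  by have := @F_increment 0 x; rewrite x0 x1 ltrN10 => /(_ isT isT isT); lra.
have c2 : F x - G x @[x --> (-1)^'+] --> F 0 - G 0.
  have : (fun _ : R => F 0 - G 0) x @[x --> (-1)^'+] --> F 0 - G 0 by exact:
    cvg_cst.
  apply: cvg_trans; apply: near_eq_cvg.
  near=> x; have x0 : x < 0 by near: x; apply: nbhs_right_lt; exact: ltrN10.
  have x1 : -1 < x by near: x; exact: nbhs_right_gt.
  by have := @F_increment x 0; rewrite x0 x1 ltr01 => /(_ isT isT isT); lra.
have e1 : F 0 - G 0 = F 1 - 0.
  by apply: (cvg_unique _ c1 (cvgB F1 G1)); exact: norm_hausdorff.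
have e2 : F 0 - G 0 = F (-1) - 0.
  by apply: (cvg_unique _ c2 (cvgB FN1 GN1)); exact: norm_hausdorff.
have -> : F 1 = F (-1) by move: e1 e2; lra.
by rewrite /F set_itv1 Rintegral_set1.
Unshelve. all: end_near. Qed.

Lemma green_legendre_op :
  \int[mu]_(x in `]-1, 1[) (q.[x] * legendre_op B x) =
  \int[mu]_(x in `[-1, 1]) (B x * legendre_op (horner q) x).
Proof.
have : \int[mu]_(x in `]-1, 1[) f0 x = 0.
  rewrite -F_end /F /f -Rintegral_mkcondr setIidr //.
  exact: subset_itv_oo_cc.
have mI : measurable (`]-1, 1[%classic : set (measurableTypeR R)) by [].

rewrite /f0 (RintegralB mI iBL iqL) => /eqP.
rewrite subr_eq0 => /eqP <-.
(* The endpoints are null sets; they are added one at a time. *)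
have iBL' : mu.-integrable `]-1, 1] (EFin \o (fun x => B x * L.[x])).
  apply: (@integrableS _ _ _ mu `[-1, 1]) => //.
    by apply: subset_itvr; rewrite bnd_simp.
  apply: integrable_segment; apply: within_continuousM => //.
  by apply: continuous_subspaceT => x; exact: continuous_horner.
rewrite (Rintegral_itv_bndo_bndc iBL) (Rintegral_itv_obnd_cbnd iBL').
by apply: eq_Rintegral => x _; rewrite legendre_op_horner.
Qed.

End Green.

(** * The response formulas *)

Lemma verblunsky_path_cvg (R : realType) (B : R -> R) (m : nat) :
  {within `[-1, 1], continuous B} ->
  (forall x : R, x \in `[-1, 1] -> B (- x) = B x) ->
  h^-1 * (verblunsky_path B m h - verblunsky_path B m 0) @[h --> 0^'] -->
    (2 * (2 * m.+1%:R + 1))^-1 *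
      \int[lebesgue_measure]_(x in `[-1, 1])
        (B x * legendre_op (fun y => (legendre R m.+1).[y] ^+ 2) x).
Proof.
move=> cB B_even.
have E t : verblunsky_path B m t = reflection (tilt B t) m.
  exact: verblunsky_reflection.
under eq_fun do rewrite !E.
pose I := \int[lebesgue_measure]_(x in `[-1, 1])
  (B x * legendre_op (fun y => (legendre R m.+1).[y] ^+ 2) x).
(* The constant is [c_m c_(m+1) / 2] divided by the squared norm [2 c_m^2 (m+1)], where
   [c_(m+1) / c_m = (2m+2)/(2m+3)]. *)
have -> : (2 * (2 * m.+1%:R + 1))^-1 * I =
    form B (szego (tilt B 0) m.+1) (rev_poly m (szego (tilt B 0) m)) /
      form (tilt B 0) (szego (tilt B 0) m) (szego (tilt B 0) m).
  rewrite tilt0 form_szego_legendre // szego_legendre_norm -/I /=.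
  have c0 := szego_scale_neq0 R m.
  rewrite natrD natrM -[m.+1%:R]natr1.
  have m0 : (0 : R) <= m%:R by rewrite ler0n.
  by field; apply/and3P; split=> //; rewrite gt_eqF //; lra.
exact: reflection_derivative.
Qed.

Unset Implicit Arguments.

Theorem theorem4p2 (R : realType) (B : R -> R) (n : nat)
    (B_cont : {within `[-1, 1], continuous B})
    (B_even : forall x : R, x \in `[-1, 1] -> B (- x) = B x)
    (n_ge1 : (1 <= n)%N) :
  [/\ derivable (verblunsky_path B n.-1) 0 1,
      response n B =
        (2 * (2 * n%:R + 1))^-1 *
        \int[lebesgue_measure]_(x in `[-1, 1])
          (B x * legendre_op (fun y => (legendre R n).[y] ^+ 2) x) &
      C2_on_interior B ->
      lebesgue_measure.-integrable `]-1, 1[ (EFin \o legendre_op B) ->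
      (1 - x ^+ 2) * derive1 B x @[x --> (-1)^'+] --> (0 : R) ->
      (1 - x ^+ 2) * derive1 B x @[x --> 1^'-] --> (0 : R) ->
      response n B =
        (2 * (2 * n%:R + 1))^-1 *
        \int[lebesgue_measure]_(x in `]-1, 1[)
          ((legendre R n).[x] ^+ 2 * legendre_op B x)].
Proof.
case: n n_ge1 => // m _.
have D := @verblunsky_path_cvg R B m B_cont B_even.
have RE : response m.+1 B = (2 * (2 * m.+1%:R + 1))^-1 *
    \int[lebesgue_measure]_(x in `[-1, 1])
      (B x * legendre_op (fun y => (legendre R m.+1).[y] ^+ 2) x).
  apply: (cvg_lim (@norm_hausdorff _ _)).
  by under eq_fun do rewrite addr0; exact: D.
split; [|exact: RE|].
  apply/cvg_ex; eexists => /=.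
  by under eq_fun do rewrite scaler1 addr0; exact: D.
(* Green's identity for the polynomial [P_n^2] moves the operator onto [B]. *)
move=> B_C2 iLB limN1 lim1; rewrite RE legendre_sqrE.
rewrite -(green_legendre_op (legendre R m.+1 ^+ 2) B_cont B_C2 iLB limN1 lim1).
by congr (_ * _); apply: eq_Rintegral => x _; rewrite horner_exp.
Qed.
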